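(* Assume that for every $\xi$ the function $F(\cdot;\xi)$ is convex and differentiable with $\|\nabla F(\mathbf y;\xi)-\nabla F(\mathbf x;\xi)\|\le L\|\mathbf x-\mathbf y\|$ for all $\mathbf x,\mathbf y\in\mathbb R^p$, that $F$ is $\mu$-strongly convex with $\mu\ge 0$ (i.e. $F(\mathbf y)-F(\mathbf x)\ge\langle\nabla F(\mathbf x),\mathbf y-\mathbf x\rangle+\frac{\mu}{2}\|\mathbf x-\mathbf y\|^2$ for all $\mathbf x,\mathbf y$), and that $\sigma_{\mathbf A^\perp,*}^2:=\mathbb E\|\mathcal P_{\mathbf A^\perp}(\nabla F(\widetilde{\mathbf x}^*;\xi))\|^2$ and $\sigma_{\mathbf A,*}^2:=\mathbb E\|\mathcal P_{\mathbf A}(\nabla F(\widetilde{\mathbf x}^*;\xi))\|^2$ are finite. Set $$\widetilde\sigma_{\mathbf A,*}^2=\sigma_{\mathbf A,*}^2+(E-1)\|\nabla F(\widetilde{\mathbf x}^* )\|^2 .$$ Run DP-SGD for $T$ iterations with $\mathrm{gap}(\mathcal I_T)=E\ge1$ and a constant learning rate $\eta_t=\eta\le\min\{\frac1{L(E+9)},\frac1{\mu+25L(E-1)}\}$. Let $\Delta^2=\mathbb E\|\mathcal P_{\mathbf A^\perp}(\mathbf x_0)-\widetilde{\mathbf x}^*\|^2$. Then the output $\hat{\mathbf y}$ satisfies $$\mathbb E[F(\hat{\mathbf y})-F(\widetilde{\mathbf x}^* )]\le O\Big(\min\Big\{\frac1T,(1-\mu\eta)^T\Big\}\frac{\Delta^2}{\eta}\Big)+O(\eta\,\sigma_{\mathbf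 A^\perp,*}^2)+O\big((E-1)L\eta^2\widetilde\sigma_{\mathbf A,*}^2\big).$$ Moreover, for an appropriate choice of the constant step size $\eta$: if $\mu=0$, $$\mathbb E[F(\hat{\mathbf y})-F(\widetilde{\mathbf x}^* )]=O\Big(\frac{LE\Delta^2}{T}+\frac{\Delta}{\sqrt T}\sigma_{\mathbf A^\perp,*}+\frac{\sqrt[3]{(E-1)L\Delta^4}}{T^{2/3}}\widetilde\sigma_{\mathbf A,*}^{2/3}\Big),$$ and if $\mu>0$, with $\kappa=L/\mu$, $$\mathbb E[F(\hat{\mathbf y})-F(\widetilde{\mathbf x}^* )]=\widetilde O\Big(LE\Delta^2\exp\Big(-\Theta\Big(\frac{T}{\kappa E}\Big)\Big)+\frac{\sigma_{\mathbf A^\perp,*}^2}{\mu T}+\frac{(E-1)L\,\widetilde\sigma_{\mathbf A,*}^2}{\mu^2T^2}\Big).$$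
   Context: Problem: minimize $F(\mathbf x)=\mathbb E_{\xi\sim\mathcal D}F(\mathbf x;\xi)$ over $\mathbf x\in\mathbb R^p$ subject to $\mathbf A^\top\mathbf x=\mathbf 0$, where $\mathbf A$ is a matrix such that this system has non-trivial solutions, and $\nabla F(\mathbf x)=\mathbb E_\xi\nabla F(\mathbf x;\xi)$. $\mathcal R(\mathbf A)$ is the column space of $\mathbf A$ and $\mathcal R(\mathbf A^\perp)=\{\mathbf x:\mathbf A^\top\mathbf x=\mathbf 0\}$ its orthogonal complement; $\mathcal P_{\mathbf A}$ and $\mathcal P_{\mathbf A^\perp}$ are the orthogonal projections onto $\mathcal R(\mathbf A)$ and $\mathcal R(\mathbf A^\perp)$. $\widetilde{\mathbf x}^*\in\arg\min_{\mathbf x\in\mathcal R(\mathbf A^\perp)}F(\mathbf x)$ is a constrained minimizer (assumed to exist). Norms are Euclidean. DP-SGD (Delayed Projected SGD): the input is an initial point $\mathbf x_0$, step sizes $\eta_t$, and a set $\mathcal I_T$ of projection times. For $t=1,\dots,T$: set $\mathbf x_t=\mathbf x_{t-1}-\eta_{t-1}\nabla F(\mathbf x_{t-1};\xi_{t-1})$ with $\xi_0,\xi_1,\dots$ i.i.d. from $\mathcal D$ (independent of $\mathbf x_0$); if $t\in\mathcal I_T$, replace $\mathbf x_t$ by $\mathcal P_{\mathbf A^\perp}(\mathbf x_t)$. The output, for constant step size $\eta$, is $\hat{\mathbf y}=\mathcal P_{\mathbf A^\perp}\big(\frac1{W_T}\sum_{j=0}^{T-1}(1-\mu\eta)^{T-j-1}\mathbf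 x_j\big)$ with $W_T=\sum_{j=0}^{T-1}(1-\mu\eta)^{T-j-1}$. $\mathrm{gap}(\mathcal I_T)$ is the largest difference between consecutive elements of $\mathcal I_T$ in sorted order, where $0$ and $T$ are counted as elements of $\mathcal I_T$ and $\mathbf x_0\in\mathcal R(\mathbf A^\perp)$ (projection time $0$). $O(\cdot)$ and $\Theta(\cdot)$ hide absolute constants; $\widetilde O(\cdot)$ additionally hides logarithmic factors. *)

(* Defs.v *)
From HB Require Import structures.
From mathcomp Require Import all_boot all_order all_algebra.
From mathcomp Require Import all_classical all_reals all_analysis.

Set Implicit Arguments.
Unset Strict Implicit.
Unset Printing Implicit Defensive.

Import Order.TTheory GRing.Theory Num.Theory.
Import numFieldNormedType.Exports.

Local Open Scope classical_set_scope.
Local Open Scope ring_scope.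

Section Euclidean.
Context {R : realType} {p : nat}.
Implicit Types (x y : 'cV[R]_p) (g : 'cV[R]_p -> R).

(* The library's norm on matrices is the sup norm, which induces the same
   topology but is not the norm meant here. *)
Definition inner x y : R := (x^T *m y) 0 0.
Definition enorm x : R := Num.sqrt (inner x x).

Definition grad g x : 'cV[R]_p := \col_i 'D_(delta_mx i 0) g x.

Definition lipschitz_grad (L : R) g : Prop :=
  forall x y, enorm (grad g y - grad g x) <= L * enorm (x - y).

Definition strongly_convex (mu : R) g : Prop :=
  forall x y, inner (grad g x) (y - x) + mu / 2 * enorm (x - y) ^+ 2 <= g y - g x.

End Euclidean.

Section Projection.
Context {R : realType} {p m : nat}.
Variable A : 'M[R]_(p, m).
Implicit Types x : 'cV[R]_p.

(* R(A) is the row space of A^T, and R(A^perp) = {x | A^T x = 0} is, transposed,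
   the row space of [kermx A]; [proj_mx U V] acts on row vectors and projects
   onto U along V. *)
Definition projA x : 'cV[R]_p := (x^T *m proj_mx <<A^T>>%MS (kermx A))^T.
Definition projAperp x : 'cV[R]_p := (x^T *m proj_mx (kermx A) <<A^T>>%MS)^T.

Definition in_Aperp x : Prop := A^T *m x = 0.

Definition constrained_min (F : 'cV[R]_p -> R) (xs : 'cV[R]_p) : Prop :=
  in_Aperp xs /\ forall x, in_Aperp x -> F xs <= F x.

Lemma capmx_ker_range : (kermx A :&: <<A^T>> = 0)%MS.
Proof.
apply/eqP; rewrite -submx0; apply/row_subP => i.
have : (row i (kermx A :&: <<A^T>>) <= kermx A :&: <<A^T>>)%MS by exact: row_sub.
move: (row i _) => v.
rewrite sub_capmx genmxE => /andP[/sub_kermxP vA /submxP[u uE]].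
have vv : v *m v^T = 0 by rewrite {2}uE trmx_mul trmxK mulmxA vA mul0mx.
suff -> : v = 0 by exact: sub0mx.
apply/rowP => j; rewrite mxE.
have := congr1 (fun M : 'M[R]_1 => M 0 0) vv.
rewrite mxE [in RHS]mxE => /psumr_eq0P v0.
have {}v0 : forall k, v 0 k * v^T k 0 = 0.
  by move=> k; apply: v0 => // l _; rewrite mxE -expr2 sqr_ge0.
have /eqP := v0 j.
by rewrite mxE -expr2 sqrf_eq0 => /eqP.
Qed.

Lemma addsmx_ker_range : (kermx A + <<A^T>> :=: 1%:M)%MS.
Proof.
apply/eqmxP; rewrite submx1 sub1mx /row_full.
rewrite (mxrank_disjoint_sum capmx_ker_range) mxrank_ker genmxE mxrank_tr.
by rewrite subnK ?rank_leq_row /= ?eqxx.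
Qed.

Lemma projA_range x : exists u, projA x = A *m u.
Proof.
have : (x^T *m proj_mx <<A^T>>%MS (kermx A) <= A^T)%MS.
  by rewrite (submx_trans (proj_mx_sub _ _ _)) // genmxE.
move=> /submxP[u uE]; exists u^T.
by rewrite /projA uE trmx_mul trmxK.
Qed.

Lemma projAperp_in x : in_Aperp (projAperp x).
Proof.
have /sub_kermxP h := proj_mx_sub (kermx A) <<A^T>>%MS x^T.
by rewrite /in_Aperp /projAperp -trmx_mul h trmx0.
Qed.

Lemma projA_add x : projAperp x + projA x = x.
Proof.
rewrite /projA /projAperp -linearD /= add_proj_mx ?trmxK ?capmx_ker_range //.
by rewrite addsmx_ker_range submx1.
Qed.

End Projection.

Section Algorithm.
Context {R : realType} {p m : nat} {Xi : Type}.
Variables (A : 'M[R]_(p, m)) (f : 'cV[R]_p -> Xi -> R).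

Fixpoint dpsgd (I : pred nat) (eta : nat -> R) (x0 : 'cV[R]_p) (xi : nat -> Xi)
    (t : nat) : 'cV[R]_p :=
  if t is s.+1 then
    let x := dpsgd I eta x0 xi s in
    let z := x - eta s *: grad (f ^~ (xi s)) x in
    if I s.+1 then projAperp A z else z
  else x0.

Definition weight (mu eta : R) (T j : nat) : R := (1 - mu * eta) ^+ (T - j - 1).

Definition dpsgd_output (I : pred nat) (mu eta : R) (T : nat)
    (x0 : 'cV[R]_p) (xi : nat -> Xi) : 'cV[R]_p :=
  projAperp A ((\sum_(j < T) weight mu eta T j)^-1 *:
    \sum_(j < T) weight mu eta T j *: dpsgd I (fun=> eta) x0 xi j).

End Algorithm.

(* 0 and T always count, whether or not they belong to I. *)
Definition projection_times (T : nat) (I : pred nat) : seq nat :=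
  [seq t <- iota 0 T.+1 | [|| t == 0%N, t == T | I t]].

(* [pairmap] starts from 0, the first projection time, so its first difference
   is 0 and does not affect the maximum. *)
Definition gap (T : nat) (I : pred nat) : nat :=
  \max_(d <- pairmap (fun s t => (t - s)%N) 0%N (projection_times T I)) d.

Section Stochastic.
Context {R : realType} {p m : nat} {d d' : measure_display}.
Context {Xi : measurableType d} {Omega : measurableType d'}.
Variables (D : probability Xi R) (P : probability Omega R).

Definition borel_vec : set (set 'cV[R]_p) := <<s [set U | open U] >>.

(* Mutual independence of x0, xi_0, ..., xi_(n-1) for every n; taking some of
   the sets full gives the product rule for all finite subfamilies. *)
Definition iid_sample (x0 : Omega -> 'cV[R]_p) (xi : nat -> Omega -> Xi) : Prop :=
  [/\ forall B, borel_vec B -> measurable (x0 @^-1` B),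
      forall i, measurable_fun setT (xi i),
      forall i S, measurable S -> P (xi i @^-1` S) = D S
    & forall n (B : set 'cV[R]_p) (S : nat -> set Xi),
        borel_vec B -> (forall i, measurable (S i)) ->
        P (x0 @^-1` B `&` \bigcap_(i < n) (xi i @^-1` S i)) =
        (P (x0 @^-1` B) * \prod_(i < n) P (xi i @^-1` S i))%E].

Variable f : 'cV[R]_p -> Xi -> R.

Definition objective (x : 'cV[R]_p) : R := fine ('E_D[f x])%E.

Definition gradient_mean : Prop :=
  forall x, differentiable objective x /\
  forall i, D.-integrable setT (EFin \o (fun xi => grad (f ^~ xi) x i 0)) /\
    (grad objective x i 0)%:E = ('E_D[fun xi => (grad (f ^~ xi) x i 0)%R])%E.

Variable A : 'M[R]_(p, m).

Definition noise_perp (xs : 'cV[R]_p) : \bar R :=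
  ('E_D[fun xi => (enorm (projAperp A (grad (f ^~ xi) xs)) ^+ 2)%R])%E.

Definition noise_range (xs : 'cV[R]_p) : \bar R :=
  ('E_D[fun xi => (enorm (projA A (grad (f ^~ xi) xs)) ^+ 2)%R])%E.

Definition init_dist (x0 : Omega -> 'cV[R]_p) (xs : 'cV[R]_p) : \bar R :=
  ('E_P[fun w => (enorm (projAperp A (x0 w) - xs) ^+ 2)%R])%E.

Definition expected_error (I : pred nat) (mu eta : R) (T : nat)
    (x0 : Omega -> 'cV[R]_p) (xi : nat -> Omega -> Xi) (xs : 'cV[R]_p) : \bar R :=
  ('E_P[fun w => (objective (dpsgd_output A f I mu eta T (x0 w) (xi ^~ w))
                - objective xs)%R])%E.

End Stochastic.

(* Inversion in \bar R has 0^-1 = +oo, so a vanishing denominator imposes no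
   constraint (e.g. the second one when mu = 0 and E = 1). *)
Definition step_bound {R : realType} (L mu : R) (E : nat) : \bar R :=
  mine ((L * (E%:R + 9))%:E^-1)%E ((mu + 25 * L * (E%:R - 1))%:E^-1)%E.

(* The factor that \tilde O hides in front of a noise term b is a power of
   [logfactor (mu * T * Delta^2 / b)]; it is at least 1 for x >= 0 and of the
   order of ln x for large x. *)
Definition logfactor {R : realType} (x : R) : R := ln (expR 1 + x).

(* Main.v *)
(* With y = P x and z = x - y for P the projection onto R(A^perp), the Lyapunov function
   |y - xs|^2 + c |z|^2, with c proportional to eta L times the number of steps left
   before the next projection is due, contracts by 1 - mu eta at each step up to noise and
   gains eta (F y - F xs). For a fixed x this is an inequality between means over xi,
   obtained by integrating pointwise bounds (co-coercivity of the gradients and Young's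
   inequality); as xi_t is independent of the past, it passes to the expectation along
   the iterates by Fubini. Weighting by (1 - mu eta)^(T-j-1), the inequalities telescope, and
   convexity bounds the error at the averaged output. The two rates follow by taking for
   eta the minimum of the largest step and of the values balancing each noise term
   against the initial distance. *)
Require Import Defs.
From HB Require Import structures.
From mathcomp Require Import all_boot all_order all_algebra.
From mathcomp Require Import all_classical all_reals all_analysis.
From mathcomp Require Import measurable_realfun ring lra.

Set Implicit Arguments.
Unset Strict Implicit.
Unset Printing Implicit Defensive.

Import Order.TTheory GRing.Theory Num.Theory.
Import numFieldNormedType.Exports.

Local Open Scope classical_set_scope.
Local Open Scope ring_scope.

(** * Euclidean geometry and smooth convex functions *)

(** Between projections the component [z] in R(A) drifts. The mean force [grad F xs] lies in R(A)
    and keeps its direction, so its effect carries an extra factor [E - 1], while the sampling noise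
    only adds up variances: this is the shape of sigma_tilde^2. To obtain it, the cross term of [z]
    with the gradient at [xs] is averaged over xi before Young's inequality is applied to it.
    Young's parameter, of order [E - 1], lets |z|^2 grow by a factor [1 + 1 / (2 (E - 1))] per step,
    which a weight falling linearly to 0 over [E] steps can absorb.

    Noise is measured at [xs] only: co-coercivity compares the gradients at [y] and at [xs], and the
    mean of its right-hand side is a multiple of [F y - F xs], the linear term vanishing by
    optimality.

    Fubini calls for joint measurability of the sample gradients in (x, xi), whereas the hypotheses
    give measurability in xi at each fixed x; continuity in x supplies the rest. *)

Section InnerProduct.
Context {R : realType} {p : nat}.
Implicit Types (x y z : 'cV[R]_p) (a : R).

Lemma innerE x y : inner x y = \sum_i x i 0 * y i 0.
Proof. by rewrite /inner mxE; apply: eq_bigr => i _; rewrite mxE. Qed.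

Lemma innerC x y : inner x y = inner y x.
Proof. by rewrite !innerE; apply: eq_bigr => i _; rewrite mulrC. Qed.

Lemma innerDl x y z : inner (x + y) z = inner x z + inner y z.
Proof. by rewrite /inner linearD mulmxDl mxE. Qed.

Lemma innerZl a x y : inner (a *: x) y = a * inner x y.
Proof. by rewrite /inner linearZ -scalemxAl mxE. Qed.

Lemma innerNl x y : inner (- x) y = - inner x y.
Proof. by rewrite -scaleN1r innerZl mulN1r. Qed.

Lemma innerBl x y z : inner (x - y) z = inner x z - inner y z.
Proof. by rewrite innerDl innerNl. Qed.

Lemma innerDr x y z : inner z (x + y) = inner z x + inner z y.
Proof. by rewrite innerC innerDl !(innerC z). Qed.

Lemma innerZr a x y : inner y (a *: x) = a * inner y x.
Proof. by rewrite innerC innerZl innerC. Qed.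

Lemma innerNr x y : inner y (- x) = - inner y x.
Proof. by rewrite innerC innerNl innerC. Qed.

Lemma innerBr x y z : inner z (x - y) = inner z x - inner z y.
Proof. by rewrite innerDr innerNr. Qed.

Lemma inner0l x : inner 0 x = 0.
Proof. by rewrite -(scale0r 0) innerZl mul0r. Qed.

Lemma inner0r x : inner x 0 = 0.
Proof. by rewrite innerC inner0l. Qed.

Definition inner_lin :=
  (innerDl, innerDr, innerBl, innerBr, innerZl, innerZr, innerNl, innerNr,
   inner0l, inner0r).

Lemma inner_ge0 x : 0 <= inner x x.
Proof. by rewrite innerE sumr_ge0 // => i _; rewrite -expr2 sqr_ge0. Qed.

Lemma inner_eq0 x : (inner x x == 0) = (x == 0).
Proof.
apply/idP/eqP => [|->]; last by rewrite inner0l.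
rewrite innerE psumr_eq0 => [/allP h|i _]; last by rewrite -expr2 sqr_ge0.
apply/colP => i; rewrite mxE; apply/eqP.
by have := h i (mem_index_enum i); rewrite -expr2 sqrf_eq0.
Qed.

Lemma enorm_sqr x : enorm x ^+ 2 = inner x x.
Proof. by rewrite sqr_sqrtr // inner_ge0. Qed.

Lemma enormN x : enorm (- x) = enorm x.
Proof. by rewrite /enorm innerNl innerNr opprK. Qed.

Lemma inner_young a x y : 0 < a -> 2 * inner x y <= a * inner x x + a^-1 * inner y y.
Proof.
move=> a0; have := inner_ge0 (a *: x - y).
rewrite !inner_lin (innerC y x) => h.
rewrite -(ler_pM2l a0) mulrDr [a * (a^-1 * _)]mulrA divff ?lt0r_neq0 // mul1r; lra.
Qed.

Lemma inner_sqD3 x y z :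
  inner (x + y + z) (x + y + z) <= 3 * (inner x x + inner y y + inner z z).
Proof.
have := inner_ge0 (x - y); have := inner_ge0 (x - z); have := inner_ge0 (y - z).
by rewrite !inner_lin (innerC y x) (innerC z x) (innerC z y); lra.
Qed.

Lemma inner_sqD2 x y : inner (x + y) (x + y) <= 2 * (inner x x + inner y y).
Proof.
have := inner_ge0 (x - y).
by rewrite !inner_lin (innerC y x); lra.
Qed.

Lemma inner_sqBZ a x y :
  inner (x - a *: y) (x - a *: y) = inner x x - 2 * a * inner y x + a ^+ 2 * inner y y.
Proof. by rewrite !inner_lin (innerC x y); ring. Qed.

Lemma lipschitz_inner (L : R) (g : 'cV[R]_p -> R) : lipschitz_grad L g ->
  forall x y, inner (grad g y - grad g x) (grad g y - grad g x)
              <= L ^+ 2 * inner (y - x) (y - x).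
Proof.
move=> gL x y; have := gL x y.
rewrite -(enormN (x - y)) opprB => h.
by rewrite -!enorm_sqr -exprMn ler_sqr ?nnegrE ?sqrtr_ge0 // (le_trans _ h) ?sqrtr_ge0.
Qed.

(** In dimension 0 every [L], even a negative one, satisfies the Lipschitz condition, hence the
    nonzero vector. *)
Lemma lipschitz_ge0 (L : R) (g : 'cV[R]_p -> R) x : x != 0 -> lipschitz_grad L g -> 0 <= L.
Proof.
move=> x0 /(_ x 0); rewrite subr0 => h.
have ex : 0 < enorm x by rewrite sqrtr_gt0 lt0r inner_eq0 x0 inner_ge0.
by rewrite -(pmulr_lge0 _ ex) (le_trans _ h) ?sqrtr_ge0.
Qed.

End InnerProduct.

Section SmoothConvex.
Context {R : realType} {p : nat}.
Variables (g : 'cV[R]_p -> R) (L : R).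
Hypothesis convex_g : forall x y, g x + inner (grad g x) (y - x) <= g y.
Hypothesis L_ge0 : 0 <= L.
Hypothesis lip_g : lipschitz_grad L g.
Implicit Types x y : 'cV[R]_p.

Lemma grad_monotone_le x y : inner (grad g y - grad g x) (y - x) <= L * inner (y - x) (y - x).
Proof.
have := lipschitz_inner lip_g x y; move: (grad g y - _) (y - x) => u v uv.
(* Cauchy-Schwarz is replaced by Young's inequality with parameter [L^-1], so [L = 0] is treated
   apart. *)
have [L0|L0] := eqVneq L 0.
  move: uv; rewrite L0 expr0n mul0r => uv.
  have u0 : u = 0 by apply/eqP; rewrite -inner_eq0 eq_le uv inner_ge0.
  by rewrite u0 inner0l.
have Lp : 0 < L by rewrite lt0r L0.
have := @inner_young _ _ L^-1 u v; rewrite invr_gt0 invrK => /(_ Lp) h.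
have : L^-1 * inner u u <= L * inner v v.
  by rewrite mulrC ler_pdivrMr // mulrAC -expr2.
lra.
Qed.

(* Convexity at [y] and Cauchy-Schwarz give [L] in place of the usual [L / 2], which
   avoids integrating the gradient along the segment. *)
Lemma descent x y : g y <= g x + inner (grad g x) (y - x) + L * inner (y - x) (y - x).
Proof.
have := grad_monotone_le x y; have := convex_g y x.
by rewrite -(opprB y x) innerBl innerNr; lra.
Qed.

Lemma cocoercive x y : inner (grad g y - grad g x) (grad g y - grad g x)
  <= 4 * L * (g y - g x - inner (grad g x) (y - x)).
Proof.
set u := _ - _.
have [L0|L0] := eqVneq L 0.
  by have := lipschitz_inner lip_g x y; rewrite -/u L0 expr0n !(mul0r, mulr0).
have Lp : 0 < L by rewrite lt0r L0.
(* A gradient step from [y] for [g] minus its linear part at [x], a function minimal at [x]. The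
   length [1 / (2 L)] minimizes the upper bound of [descent]; the constant [L] there is why [4 L]
   replaces the usual [2 L]. *)
pose w := y - (2 * L)^-1 *: u.
have := convex_g x w; have := descent y w.
have wx : w - x = (y - x) - (2 * L)^-1 *: u by rewrite /w addrAC.
have wy : w - y = - ((2 * L)^-1 *: u) by rewrite /w addrC addKr.
rewrite wx wy.
have gy : grad g y = u + grad g x by rewrite /u subrK.
clearbody u; rewrite gy !inner_lin => h1 h2.
have : (2 * L)^-1 * inner u u - L * ((2 * L)^-1 * ((2 * L)^-1 * inner u u)) = inner u u / (4 * L).
  by field.
move=> h3.
have : inner u u / (4 * L) <= g y - g x - inner (grad g x) (y - x).
  by rewrite innerBr; lra.
by rewrite innerBr ler_pdivrMr ?mulr_gt0 //; lra.
Qed.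

End SmoothConvex.

Section OrthogonalProjections.
Context {R : realType} {p m : nat}.
Variable A : 'M[R]_(p, m).
Implicit Types x y : 'cV[R]_p.

Local Notation P := (projAperp A).
Local Notation Q := (projA A).

Lemma projAperpD x y : P (x + y) = P x + P y.
Proof. by rewrite /P /projAperp linearD mulmxDl linearD. Qed.

Lemma projAperpZ (a : R) x : P (a *: x) = a *: P x.
Proof. by rewrite /P /projAperp linearZ -scalemxAl linearZ. Qed.

Lemma projAperpB x y : P (x - y) = P x - P y.
Proof. by rewrite -scaleN1r projAperpD projAperpZ scaleN1r. Qed.

Lemma projAE x : Q x = x - P x.
Proof. by apply/eqP; rewrite eq_sym subr_eq addrC projA_add. Qed.

Lemma projAD x y : Q (x + y) = Q x + Q y.
Proof. by rewrite !projAE projAperpD opprD addrACA. Qed.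

Lemma projAZ (a : R) x : Q (a *: x) = a *: Q x.
Proof. by rewrite !projAE projAperpZ scalerBr. Qed.

Lemma projAB x y : Q (x - y) = Q x - Q y.
Proof. by rewrite -scaleN1r projAD projAZ scaleN1r. Qed.

Lemma inner_projA_Aperp x y : in_Aperp A y -> inner (Q x) y = 0.
Proof.
move=> Ay; have [u ->] := projA_range A x.
by rewrite /inner trmx_mul -mulmxA Ay mulmx0 mxE.
Qed.

Lemma inner_projA_perp x y : inner (Q x) (P y) = 0.
Proof. exact/inner_projA_Aperp/projAperp_in. Qed.

Lemma in_AperpB x y : in_Aperp A x -> in_Aperp A y -> in_Aperp A (x - y).
Proof. by rewrite /in_Aperp mulmxBr => -> ->; rewrite subr0. Qed.

Lemma in_AperpZ (a : R) x : in_Aperp A x -> in_Aperp A (a *: x).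
Proof. by rewrite /in_Aperp -scalemxAr => ->; rewrite scaler0. Qed.

(** [Q x = x - P x] then lies in R(A^perp) as well as in R(A), so it is orthogonal to itself. *)
Lemma projA_id0 x : in_Aperp A x -> Q x = 0.
Proof.
move=> Ax; apply/eqP; rewrite -inner_eq0 inner_projA_Aperp // projAE.
exact/in_AperpB/projAperp_in.
Qed.

Lemma projAperp_id x : in_Aperp A x -> P x = x.
Proof. by move=> Ax; rewrite -[RHS](projA_add A x) (projA_id0 Ax) addr0. Qed.

Lemma inner_projAperpl x y : in_Aperp A y -> inner (P x) y = inner x y.
Proof.
by move=> Ay; rewrite -[in RHS](projA_add A x) innerDl inner_projA_Aperp // addr0.
Qed.

Lemma inner_proj_pythagoras x : inner x x = inner (P x) (P x) + inner (Q x) (Q x).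
Proof.
rewrite -{1 2}(projA_add A x) !innerDl !innerDr (innerC (projAperp A x) (projA A x)).
by rewrite !inner_projA_perp addr0 add0r.
Qed.

Lemma inner_projAperp_le x : inner (P x) (P x) <= inner x x.
Proof. by rewrite (inner_proj_pythagoras x) lerDl inner_ge0. Qed.

Lemma inner_projA_le x : inner (Q x) (Q x) <= inner x x.
Proof. by rewrite (inner_proj_pythagoras x) lerDr inner_ge0. Qed.

End OrthogonalProjections.

(** * Gradients and means *)

Section GradientOfConvex.
Context {R : realType} {p : nat}.
Implicit Types (g : 'cV[R]_p -> R) (x y v : 'cV[R]_p).

Lemma derive_inner_grad g x v : differentiable g x -> 'D_v g x = inner (grad g x) v.
Proof.
move=> dg; rewrite deriveE //.
have {1}-> : v = \sum_i v i 0 *: delta_mx i 0.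
  by rewrite {1}(matrix_sum_delta v); apply: eq_bigr => i _; rewrite big_ord1.
rewrite linear_sum innerE; apply: eq_bigr => i _.
by rewrite linearZ /= -deriveE // mxE mulrC.
Qed.

(** For [0 < h <= 1] convexity bounds the difference quotient from [x] towards [y] by [g y - g x].
    This is false for negative [h], so the derivative is taken as a limit from the right. *)
Lemma convex_grad_le g : convex_function setT g -> (forall x, differentiable g x) ->
  forall x y, g x + inner (grad g x) (y - x) <= g y.
Proof.
move=> cg dg x y; rewrite -derive_inner_grad // addrC -lerBrDr.
rewrite /derive.
have cvgD : cvg (h^-1 *: ((g \o shift x) (h *: (y - x)) - g x) @[h --> 0^']).
  exact: diff_derivable.
rewrite cvg_at_rightE //.
apply: limr_le.
  by apply/cvg_ex; exists (lim (h^-1 *: ((g \o shift x) (h *: (y - x)) - g x) @[h --> 0^']));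
    apply: cvg_dnbhs_at_right.
near=> h.
have h0 : 0 < h by near: h; exact: nbhs_right_gt.
have h1 : h <= 1 by near: h; apply: nbhs_right_le.
have := cg (Itv01 (ltW h0) h1) y x; rewrite !in_setE => /(_ I I).
have -> : conv (Itv01 (ltW h0) h1) (y : convex_lmodType 'cV[R]_p) x = h *: (y - x) + x.
  rewrite /conv /= /unstable.onem scalerBl scale1r scalerBr.
  by rewrite -addrA [- (h *: x) + x]addrC.
rewrite convRE /= /unstable.onem => hc.
by rewrite -[_ *: _]/(h^-1 * _) ler_pdivrMl //; lra.
Unshelve. all: by end_near.
Qed.

End GradientOfConvex.

Section Means.
Context {d : measure_display} {T : measurableType d} {R : realType}.
Variable D : probability T R.
Implicit Types (h k : T -> R) (a b : R).

(** Integrability is bundled with a real value, so that means combine by linear arithmetic in [R]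
    instead of [\bar R]. *)
Definition has_mean h a : Prop :=
  D.-integrable setT (EFin \o h) /\ (\int[D]_x (h x)%:E = a%:E)%E.

Lemma has_mean_cst a : has_mean (fun=> a) a.
Proof.
split; first by apply: finite_measure_integrable_cst.
rewrite integral_cst //; transitivity (a%:E * 1)%E; last by rewrite mule1.
congr (_ * _)%E; exact: (@probability_setT _ _ _ D).
Qed.

Lemma has_meanD h k a b : has_mean h a -> has_mean k b -> has_mean (fun x => h x + k x) (a + b).
Proof.
move=> [ih ha] [ik kb]; split.
  rewrite (_ : _ \o _ = (EFin \o h) \+ (EFin \o k))%E //; exact: integrableD.
by have := integralD_EFin measurableT ih ik; rewrite EFinD -ha -kb.
Qed.

Lemma has_meanZ h a b : has_mean h a -> has_mean (fun x => b * h x) (b * a).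
Proof.
move=> [ih ha]; split.
  rewrite (_ : _ \o _ = (fun x => b%:E * (EFin \o h) x)%E) //; exact: integrableZl.
by rewrite EFinM -ha -(integralZl _ ih).
Qed.

Lemma has_meanB h k a b : has_mean h a -> has_mean k b -> has_mean (fun x => h x - k x) (a - b).
Proof.
move=> ha /(has_meanZ (-1)) kb; have := has_meanD ha kb; rewrite mulN1r.
by congr has_mean; apply/funext => x; rewrite mulN1r.
Qed.

Lemma has_mean_sum n (h : 'I_n -> T -> R) (a : 'I_n -> R) :
  (forall i, has_mean (h i) (a i)) -> has_mean (fun x => \sum_i h i x) (\sum_i a i).
Proof.
elim: n h a => [|n IH] h a ha.
  under eq_fun do rewrite big_ord0; rewrite big_ord0; exact: has_mean_cst.
under eq_fun do rewrite big_ord_recl.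
rewrite big_ord_recl; apply: has_meanD => //; exact: IH.
Qed.

Lemma has_mean_le h k a b : has_mean h a -> has_mean k b -> (forall x, h x <= k x) -> a <= b.
Proof.
move=> [ih ha] [ik kb] hk; rewrite -lee_fin -ha -kb.
by apply: le_integral => // x _; rewrite lee_fin.
Qed.

Lemma has_mean_integral h a : has_mean h a -> (\int[D]_x (h x)%:E = a%:E)%E.
Proof. by case. Qed.

Lemma has_mean_fine h : D.-integrable setT (EFin \o h) ->
  has_mean h (fine ('E_D[h])%E).
Proof.
move=> ih; split=> //; rewrite expectation.unlock fineK //.
exact: integrable_fin_num.
Qed.

Lemma ge0_has_mean_fine h : measurable_fun setT h -> (forall x, 0 <= h x) ->
  ('E_D[h])%E \is a fin_num -> has_mean h (fine ('E_D[h])%E).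
Proof.
move=> mh h0 hfin; apply: has_mean_fine.
apply/integrableP; split; first exact/measurable_EFinP.
have -> : (\int[D]_x `|(EFin \o h) x|)%E = ('E_D[h])%E.
  rewrite expectation.unlock; apply: eq_integral => x _ /=.
  by rewrite ger0_norm.
by rewrite ltey_eq hfin.
Qed.

Lemma has_mean_inner p (g : T -> 'cV[R]_p) (v w : 'cV[R]_p) :
  (forall i, has_mean (fun x => g x i 0) (v i 0)) ->
  has_mean (fun x => inner (g x) w) (inner v w).
Proof.
move=> gv; rewrite innerE; under eq_fun do rewrite innerE.
apply: has_mean_sum => i; rewrite mulrC; under eq_fun do rewrite mulrC.
exact: has_meanZ.
Qed.

End Means.

(** * Independence *)

Section Freezing.
Local Open Scope ereal_scope.
Context {d1 d2 d3 : measure_display} {Omega : measurableType d1}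
  {Y : measurableType d2} {Z : measurableType d3} {R : realType}.
Variables (P : probability Omega R) (D : probability Z R).
Variables (X : {mfun Omega >-> Y}) (zeta : {mfun Omega >-> Z}).
Hypothesis indep : forall A B, measurable A -> measurable B ->
  P (X @^-1` A `&` zeta @^-1` B) = P (X @^-1` A) * D B.

(** The joint law of [(X, zeta)] agrees with the product of the law of [X] and [D] on rectangles,
    hence everywhere; Tonelli does the rest. [indep] at [A = setT] contains the fact that [zeta] has
    law [D]. *)
Lemma integral_indep (phi : Y * Z -> \bar R) : measurable_fun [set: Y * Z] phi ->
  (forall u, 0 <= phi u) ->
  \int[P]_w phi (X w, zeta w) = \int[P]_w \int[D]_z phi (X w, z).
Proof.
move=> mphi phi0.
have mJ : measurable_fun setT (fun w => (X w, zeta w)).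
  by apply: measurable_fun_pair; exact: measurable_funP.
pose Jm := isMeasurableFun.Build _ _ _ _ _ mJ.
pose J : {mfun Omega >-> (Y * Z)%type} := HB.pack (fun w => (X w, zeta w)) Jm.
rewrite -[LHS](@ge0_integral_distribution _ _ _ _ _ P J phi mphi phi0).
rewrite (eq_measure_integral (distribution P X \x D)%E); last first.
  move=> A mA _; apply/esym; apply: product_measure_unique => // B C mB mC; exact: indep.
rewrite fubini_tonelli1 //.
rewrite ge0_integral_distribution //; last by move=> y; exact: integral_ge0.
exact: measurable_fun_fubini_tonelli_F.
Qed.

End Freezing.

Section IndependentPiSystem.
Local Open Scope ereal_scope.
Context {d1 d3 : measure_display} {Omega : measurableType d1}
  {Z : measurableType d3} {R : realType}.
Variables (P : probability Omega R) (D : probability Z R).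
Variable G : set (set Omega).
Hypotheses (GT : G setT) (GI : setI_closed G) (Gm : G `<=` measurable).
Variable zeta : Omega -> Z.
Hypothesis mzeta : measurable_fun setT zeta.
Hypothesis indep : forall A B, G A -> measurable B ->
  P (A `&` zeta @^-1` B) = P A * D B.

(** For fixed [B] both sides are finite measures in [A] that agree on the pi-system [G], which
    contains the whole space. *)
Lemma indep_sigma A B : <<s G >> A -> measurable B ->
  P (A `&` zeta @^-1` B) = P A * D B.
Proof.
move=> sA mB.
have mzB : measurable (zeta @^-1` B) by rewrite -[_ @^-1` _]setTI; exact: mzeta.
have DB : D B \is a fin_num by exact: fin_num_measure.
have DB0 : (0 <= fine (D B))%R by exact: fine_ge0.
have cover : \bigcup_(_ : nat) [set: Omega] = setT by rewrite bigcup_const //; exists 0%N.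
have -> : P (A `&` zeta @^-1` B) = mscale (NngNum DB0) P A.
  apply: (g_sigma_algebra_measure_unique G Gm (fun=> setT) (fun=> GT) cover
    (mrestr P mzB) (mscale (NngNum DB0) P) GI) => //.
  - by move=> C GC; rewrite -[RHS]/((fine (D B))%:E * P C) fineK // muleC -indep.
  - by move=> _; rewrite ltey_eq fin_num_measure //; exact: measurableI.
by rewrite -[LHS]/((fine (D B))%:E * P A) fineK // muleC.
Qed.

(** With [X] the identity from [Omega] to [Omega] carrying the smaller sigma-algebra, the whole past
    is frozen at once. *)
Lemma integral_indep_sigma (phi : g_sigma_algebraType G * Z -> \bar R) :
  measurable_fun [set: g_sigma_algebraType G * Z] phi -> (forall u, 0 <= phi u) ->
  \int[P]_w phi (w, zeta w) = \int[P]_w \int[D]_z phi (w, z).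
Proof.
move=> mphi phi0.
have mid : measurable_fun setT (fun w : Omega => w : g_sigma_algebraType G).
  move=> _ A mA; rewrite setTI.
  by apply: smallest_sub mA => //; exact: sigma_algebra_measurable.
pose Xm := isMeasurableFun.Build _ _ _ _ _ mid.
pose X : {mfun Omega >-> g_sigma_algebraType G} :=
  HB.pack (fun w : Omega => w : g_sigma_algebraType G) Xm.
pose zm := isMeasurableFun.Build _ _ _ _ _ mzeta.
pose z : {mfun Omega >-> Z} := HB.pack zeta zm.
apply: (@integral_indep _ _ _ _ _ _ _ P D X z) => //.
by move=> A B mA mB; exact: indep_sigma.
Qed.

End IndependentPiSystem.

(** * Measurability *)

Section Caratheodory.
Context {R : realType}.

Lemma cvg_col p (F : set_system nat) {FF : Filter F} (u : nat -> 'cV[R]_p) (x : 'cV[R]_p) :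
  (forall i, u n i 0 @[n --> F] --> x i 0) -> u n @[n --> F] --> x.
Proof.
move=> ux A [B xB BA].
have h : \forall n \near F, forall i j, B i j (u n i j).
  apply: filter_forall => i; apply: filter_forall => j.
  by rewrite ord1; apply: (ux i); have := xB i 0.
by near do apply: BA; exact: h.
Unshelve. all: by end_near.
Qed.

Lemma cvg_sumr n (u : 'I_n -> nat -> R) (l : 'I_n -> R) :
  (forall i, u i k @[k --> \oo] --> l i) -> \sum_i u i k @[k --> \oo] --> \sum_i l i.
Proof.
elim: n u l => [|n IH] u l ul.
  rewrite big_ord0 (_ : (fun k => _) = fun=> 0); first exact: cvg_cst.
  by apply/funext => k; rewrite big_ord0.
rewrite big_ord_recl (_ : (fun k => _) = fun k => u ord0 k + \sum_i u (lift ord0 i) k); last first.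
  by apply/funext => k; rewrite big_ord_recl.
by apply: cvgD => //; exact: IH.
Qed.

Context {d1 d2 : measure_display} {T : measurableType d1} {Z : measurableType d2}.
Context {p : nat}.

(** The index is a finite function into [int] because these form a countable type; [n.+1] keeps the
    mesh defined at [n = 0]. *)
Definition grid n (k : {ffun 'I_p -> int}) : 'cV[R]_p := \col_i ((k i)%:~R / n.+1%:R).

Definition grid_index n (x : 'cV[R]_p) : {ffun 'I_p -> int} :=
  [ffun i => Num.floor (n.+1%:R * x i 0)].

Lemma grid_dist n (x : 'cV[R]_p) i : `|x i 0 - grid n (grid_index n x) i 0| <= n.+1%:R^-1.
Proof.
rewrite mxE ffunE; set y := x i 0.
have /andP[h1 h2] := floor_itv (n.+1%:R * y).
have n0 : 0 < n.+1%:R :> R by rewrite ltr0n.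
have -> : y - (Num.floor (n.+1%:R * y))%:~R / n.+1%:R =
  (n.+1%:R * y - (Num.floor (n.+1%:R * y))%:~R) / n.+1%:R.
  by field; rewrite addrC natr1 lt0r_neq0.
rewrite ger0_norm; last by rewrite divr_ge0 // subr_ge0.
rewrite ler_pdivrMr // mulVf ?lt0r_neq0 // lerBlDr.
by move: h2; rewrite rmorphD /= addrC => /ltW.
Qed.

Lemma grid_cvg (x : 'cV[R]_p) i : grid n (grid_index n x) i 0 @[n --> \oo] --> x i 0.
Proof.
apply/cvgrPdist_le => /= e e0.
have /cvgrPdist_le/(_ _ e0) := @cvg_harmonic R.
apply: filterS => n; rewrite /= sub0r normrN => h.
apply: le_trans (grid_dist n x i) _; apply: le_trans h.
by rewrite /harmonic ger0_norm.
Qed.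

(* [H] is approximated by grid points: along each of the countably many values of the
   grid index, [h] only has to be measurable in its second argument. *)
Lemma measurable_caratheodory (h : 'cV[R]_p -> Z -> R) (H : T -> 'cV[R]_p) (zeta : T -> Z) :
  (forall z (u : nat -> 'cV[R]_p) (x : 'cV[R]_p), (forall i, u n i 0 @[n --> \oo] --> x i 0) ->
     h (u n) z @[n --> \oo] --> h x z) ->
  (forall x, measurable_fun setT (h x)) ->
  (forall i, measurable_fun setT (fun t => H t i 0)) ->
  measurable_fun setT zeta ->
  measurable_fun setT (fun t => h (H t) (zeta t)).
Proof.
move=> hc hm mH mz.
apply: (@measurable_fun_cvg _ _ _ _ (fun n t => h (grid n (grid_index n (H t))) (zeta t))).
  move=> n _ Y mY; rewrite setTI.
  have -> : (fun t => h (grid n (grid_index n (H t))) (zeta t)) @^-1` Y =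
    \bigcup_(k : {ffun 'I_p -> int})
      ((\bigcap_(i : 'I_p) [set t | Num.floor (n.+1%:R * H t i 0) = k i]) `&`
        (fun t => h (grid n k) (zeta t)) @^-1` Y).
    apply/seteqP; split => [t Yt|t [k _ [tk Yt]]].
      by exists (grid_index n (H t)) => //; split => // i _; rewrite /= ffunE.
    rewrite /=; suff -> : grid_index n (H t) = k by [].
    by apply/ffunP => i; rewrite ffunE; exact: tk.
  apply: countable_bigcupT_measurable => [|k]; first exact: countableP.
  apply: measurableI.
    apply: fin_bigcap_measurable => // i _.
    have -> : [set t | Num.floor (n.+1%:R * H t i 0) = k i] =
      (fun t => n.+1%:R * H t i 0) @^-1` `[(k i)%:~R, (k i + 1)%:~R[%classic.
      apply/seteqP; split => t /=; rewrite in_itv /=.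
        by move=> <-; exact: floor_itv.
      by move=> h'; apply: floor_def.
    rewrite -[_ @^-1` _]setTI.
    by apply: (measurable_funM (measurable_cst _) (mH i)) => //.
  rewrite -[_ @^-1` _]setTI; apply: (measurableT_comp (hm _) mz) => //.
by move=> t _; apply: hc => i; exact: grid_cvg.
Qed.

Lemma measurable_fun_inner (u v : T -> 'cV[R]_p) :
  (forall i, measurable_fun setT (fun t => u t i 0)) ->
  (forall i, measurable_fun setT (fun t => v t i 0)) ->
  measurable_fun setT (fun t => inner (u t) (v t)).
Proof.
move=> mu mv; under eq_fun do rewrite innerE.
by apply: measurable_sum => i; exact: measurable_funM.
Qed.

Lemma measurable_fun_projAperp m (A : 'M[R]_(p, m)) (u : T -> 'cV[R]_p) :
  (forall i, measurable_fun setT (fun t => u t i 0)) ->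
  forall i, measurable_fun setT (fun t => projAperp A (u t) i 0).
Proof.
move=> mu i; under eq_fun do rewrite /projAperp 2!mxE.
apply: measurable_sum => j; apply: measurable_funM => //.
by under eq_fun do rewrite mxE; exact: mu.
Qed.

Lemma measurable_fun_projA m (A : 'M[R]_(p, m)) (u : T -> 'cV[R]_p) :
  (forall i, measurable_fun setT (fun t => u t i 0)) ->
  forall i, measurable_fun setT (fun t => projA A (u t) i 0).
Proof.
move=> mu i; under eq_fun do rewrite projAE !mxE.
by apply: measurable_funB => //; have := measurable_fun_projAperp A mu i;
  under eq_fun do rewrite !mxE.
Qed.

End Caratheodory.

(** * One step of the algorithm *)

Section MeanBounds.
Context {d : measure_display} {T : measurableType d} {R : realType}.
Variable D : probability T R.
Implicit Types (h k : T -> R) (a b : R).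

(** Only a majorant [k] has to be integrable. Measurability of [h] enters later, in
    [mean_le_integral]. *)
Definition mean_le h b : Prop :=
  exists k a, [/\ has_mean D k a, forall z, h z <= k z & a <= b].

Lemma mean_leD h k a b : mean_le h a -> mean_le k b -> mean_le (fun z => h z + k z) (a + b).
Proof.
move=> [h' [a' [m1 le1 l1]]] [k' [b' [m2 le2 l2]]].
exists (fun z => h' z + k' z), (a' + b'); split; first exact: has_meanD.
  by move=> z; rewrite lerD.
by rewrite lerD.
Qed.

Lemma mean_leZ h a b : 0 <= b -> mean_le h a -> mean_le (fun z => b * h z) (b * a).
Proof.
move=> b0 [h' [a' [m1 le1 l1]]].
exists (fun z => b * h' z), (b * a'); split; first exact: has_meanZ.
  by move=> z; rewrite ler_wpM2l.
by rewrite ler_wpM2l.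
Qed.

Lemma mean_le_trans h a b : mean_le h a -> a <= b -> mean_le h b.
Proof.
by move=> [h' [a' [m1 le1 l1]]] ab; exists h', a'; split => //; exact: le_trans ab.
Qed.

Lemma mean_le_integral h b : measurable_fun setT h -> (forall z, 0 <= h z) ->
  mean_le h b -> (\int[D]_z (h z)%:E <= b%:E)%E.
Proof.
move=> mh h0 [k [a [[ik ka] hk ab]]].
apply: (@le_trans _ _ a%:E); last by rewrite lee_fin.
rewrite -ka; apply: ge0_le_integral => //.
- by move=> x _; rewrite lee_fin.
- exact/measurable_EFinP.
- exact: measurable_int ik.
- by move=> x _; rewrite lee_fin.
Qed.

End MeanBounds.

Section OneStep.
Context {R : realType} {p m : nat} {d : measure_display} {Xi : measurableType d}.
Variables (A : 'M[R]_(p, m)) (D : probability Xi R) (f : 'cV[R]_p -> Xi -> R).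
Variables (L mu : R) (xs : 'cV[R]_p).
Let F := objective D f.
Local Notation P := (projAperp A).
Local Notation Q := (projA A).
Local Notation g := (fun z => grad (f ^~ z)).
Hypothesis nontrivial : exists x : 'cV[R]_p, x != 0 /\ in_Aperp A x.
Hypothesis f_int : forall x, D.-integrable setT (EFin \o f x).
Hypothesis f_diff : forall z x, differentiable (f ^~ z) x.
Hypothesis f_convex : forall z, convex_function setT (f ^~ z).
Hypothesis f_lip : forall z, lipschitz_grad L (f ^~ z).
Hypothesis f_grad : gradient_mean D f.
Hypothesis mu_ge0 : 0 <= mu.
Hypothesis F_strong : strongly_convex mu F.
Hypothesis xs_min : constrained_min A F xs.
Hypothesis perp_fin : noise_perp D f A xs \is a fin_num.
Hypothesis range_fin : noise_range D f A xs \is a fin_num.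

Let sperp2 := fine (noise_perp D f A xs).
Let srange2 := fine (noise_range D f A xs).
Implicit Types (x y v w : 'cV[R]_p) (z : Xi).

Lemma L_ge0 : 0 <= L.
Proof.
have [v [v0 _]] := nontrivial; exact: (lipschitz_ge0 v0 (f_lip point)).
Qed.

Let first_order z x y : f x z + inner (g z x) (y - x) <= f y z.
Proof. exact: (convex_grad_le (f_convex z) (f_diff z)). Qed.

Lemma has_mean_f x : has_mean D (f x) (F x).
Proof. exact: has_mean_fine. Qed.

Lemma has_mean_grad_coord x i : has_mean D (fun z => g z x i 0) (grad F x i 0).
Proof.
have [_ /(_ i) [ig Eg]] := f_grad x; split => //.
by rewrite Eg expectation.unlock.
Qed.

Lemma has_mean_grad x w : has_mean D (fun z => inner (g z x) w) (inner (grad F x) w).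
Proof. by apply: has_mean_inner => i; exact: has_mean_grad_coord. Qed.

Lemma measurable_grad x i : measurable_fun setT (fun z => g z x i 0).
Proof. by have [/measurable_int /measurable_EFinP] := has_mean_grad_coord x i. Qed.

Lemma has_mean_perp : has_mean D (fun z => inner (P (g z xs)) (P (g z xs))) sperp2.
Proof.
rewrite /sperp2 /noise_perp; move: perp_fin; rewrite /noise_perp.
under eq_fun do rewrite enorm_sqr; move=> pf.
apply: ge0_has_mean_fine => // [|z]; last exact: inner_ge0.
apply: measurable_fun_inner => i; apply: measurable_fun_projAperp => j; exact: measurable_grad.
Qed.

Lemma has_mean_range : has_mean D (fun z => inner (Q (g z xs)) (Q (g z xs))) srange2.
Proof.
rewrite /srange2 /noise_range; move: range_fin; rewrite /noise_range.
under eq_fun do rewrite enorm_sqr; move=> pf.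
apply: ge0_has_mean_fine => // [|z]; last exact: inner_ge0.
apply: measurable_fun_inner => i; apply: measurable_fun_projA => j; exact: measurable_grad.
Qed.

Lemma descent_objective x y : F y <= F x + inner (grad F x) (y - x) + L * inner (y - x) (y - x).
Proof.
apply: (has_mean_le (has_mean_f y)).
  apply: has_meanD; first by apply: has_meanD; [exact: has_mean_f|exact: has_mean_grad].
  exact: has_mean_cst.
by move=> z; apply: (descent (first_order z) L_ge0 (f_lip z)).
Qed.

Lemma objective_convex x y : F x + inner (grad F x) (y - x) <= F y.
Proof.
apply: (has_mean_le _ (has_mean_f y)).
  by apply: has_meanD; [exact: has_mean_f|exact: has_mean_grad].
by move=> z; exact: first_order.
Qed.

(** Strong convexity from [0] to [v] and back gives mu |v|^2 at most the inner product of
    [grad F v - grad F 0] with [v], which is at most L |v|^2 by averaging over the samples. It keeps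
    [mu * eta] below 1/10 under the first step condition. *)
Lemma mu_le_L : mu <= L.
Proof.
have [v [v0 _]] := nontrivial.
have v1 : 0 < inner v v by rewrite lt0r inner_eq0 v0 inner_ge0.
have h : inner (grad F v) v - inner (grad F 0) v <= L * inner v v.
  apply: (has_mean_le _ (has_mean_cst D _)).
    by apply: has_meanB; exact: has_mean_grad.
  move=> z; have := grad_monotone_le L_ge0 (f_lip z) 0 v.
  by rewrite subr0 innerBl.
have h1 := F_strong 0 v; have h2 := F_strong v 0.
move: h1 h2; rewrite -/F !enorm_sqr !subr0 !sub0r !inner_lin opprK => h1 h2.
rewrite -(ler_pM2r v1); lra.
Qed.

Lemma grad_min_orthogonal v : in_Aperp A v -> inner (grad F xs) v = 0.
Proof.
have [xsA xsm] := xs_min.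
suff H w : in_Aperp A w -> 0 <= inner (grad F xs) w.
  move=> Av; apply/le_anti; rewrite H // andbT.
  have := H (- v); rewrite innerNr oppr_ge0; apply.
  by rewrite -scaleN1r; exact: in_AperpZ.
move=> Aw; set a := inner _ _; rewrite leNgt; apply/negP => a0.
have key t : 0 <= t * a + L * (t ^+ 2 * inner w w).
  have := descent_objective xs (xs + t *: w).
  have := xsm (xs + t *: w).
  rewrite /in_Aperp mulmxDr xsA -scalemxAr Aw scaler0 addr0 => /(_ erefl).
  by rewrite [_ + _ - xs]addrC addKr !inner_lin -/a -/F; lra.
have Lw : 0 <= L * inner w w by rewrite mulr_ge0 ?L_ge0 ?inner_ge0.
(* The minimizer of [t * a + L * t ^+ 2 * inner w w], with 1 added so that the denominator is
   positive even if [L * inner w w = 0]. At [s] the expression is negative. *)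
pose s := - a / (2 * (L * inner w w + 1)).
have den : 0 < 2 * (L * inner w w + 1) by lra.
have s0 : 0 < s by rewrite divr_gt0 // oppr_gt0.
have sE : s * (2 * (L * inner w w + 1)) = - a by rewrite divfK // lt0r_neq0.
have := key s; rewrite expr2.
have -> : s * a + L * (s * s * inner w w) = s * (a + s * (L * inner w w)) by ring.
rewrite pmulr_rge0 // => h; nra.
Qed.

Let bregman z y := f y z - f xs z - inner (g z xs) (y - xs).

(** The linear term averages to the product of [grad F xs] with a vector of R(A^perp), which is 0.
    This turns co-coercivity of the samples into a bound by the objective gap. *)
Lemma has_mean_bregman x : has_mean D (bregman ^~ (P x)) (F (P x) - F xs).
Proof.
have [xsA _] := xs_min.
have -> : F (P x) - F xs = F (P x) - F xs - inner (grad F xs) (P x - xs).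
  by rewrite grad_min_orthogonal ?subr0 //; apply: in_AperpB => //; exact: projAperp_in.
apply: has_meanB; last exact: has_mean_grad.
by apply: has_meanB; exact: has_mean_f.
Qed.

Let dx x : x - P x = Q x. Proof. by rewrite projAE. Qed.

Let grad_drift z x : inner (g z x - g z (P x)) (g z x - g z (P x)) <= L ^+ 2 * inner (Q x) (Q x).
Proof. by rewrite -dx; exact: (lipschitz_inner (f_lip z)). Qed.

Let grad_coco z x : inner (g z (P x) - g z xs) (g z (P x) - g z xs) <= 4 * L * bregman z (P x).
Proof. exact: (cocoercive (first_order z) L_ge0 (f_lip z)). Qed.

(** The three parts are controlled by the drift [Q x], by the Bregman gap at [P x], and by the noise
    at [xs]. *)
Let grad_split z x : g z x = (g z x - g z (P x)) + (g z (P x) - g z xs) + g z xs.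
Proof. by rewrite addrA subrK subrK. Qed.

(** The cross term sees [g z x] itself, since [P x - xs] lies in R(A^perp). The 12 is 3 from the
    square of three summands times 4 from [cocoercive]. *)
Lemma mean_perp_step eta x : 0 <= eta ->
  mean_le D (fun z => inner (P (x - eta *: g z x) - xs) (P (x - eta *: g z x) - xs))
   ((1 - mu * eta) * inner (P x - xs) (P x - xs)
    - (2 * eta - 12 * L * eta ^+ 2) * (F (P x) - F xs)
    + (2 * eta * L + 3 * eta ^+ 2 * L ^+ 2) * inner (Q x) (Q x)
    + 3 * eta ^+ 2 * sperp2).
Proof.
move=> eta0; have [xsA _] := xs_min.
have yA : in_Aperp A (P x - xs) by apply: in_AperpB => //; exact: projAperp_in.
exists (fun z => inner (P x - xs) (P x - xs) - 2 * eta * inner (g z x) (P x - xs)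
  + 3 * eta ^+ 2 * (L ^+ 2 * inner (Q x) (Q x) + 4 * L * bregman z (P x)
      + inner (P (g z xs)) (P (g z xs)))).
exists (inner (P x - xs) (P x - xs) - 2 * eta * inner (grad F x) (P x - xs)
  + 3 * eta ^+ 2 * (L ^+ 2 * inner (Q x) (Q x) + 4 * L * (F (P x) - F xs) + sperp2)).
split.
- apply: has_meanD.
    by apply: has_meanB; [exact: has_mean_cst|apply: has_meanZ; exact: has_mean_grad].
  apply: has_meanZ; apply: has_meanD; last exact: has_mean_perp.
  by apply: has_meanD; [exact: has_mean_cst|apply: has_meanZ; exact: has_mean_bregman].
- move=> z; rewrite projAperpB projAperpZ addrAC.
  rewrite inner_sqBZ (inner_projAperpl _ yA).
  have q3 : inner (P (g z x)) (P (g z x)) <= 3 * (L ^+ 2 * inner (Q x) (Q x)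
      + 4 * L * bregman z (P x) + inner (P (g z xs)) (P (g z xs))).
    rewrite {1 2}(grad_split z x) (projAperpD _ (_ + _)) (projAperpD _ (_ - _)).
    apply: le_trans (inner_sqD3 _ _ _) _.
    rewrite ler_pM2l // !lerD //.
      exact: le_trans (inner_projAperp_le _ _) (grad_drift _ _).
    exact: le_trans (inner_projAperp_le _ _) (grad_coco _ _).
  have := ler_wpM2l (sqr_ge0 eta) q3; lra.
have h1 := F_strong x xs; have h2 := descent_objective x (P x).
have h3 : inner (x - xs) (x - xs) = inner (P x - xs) (P x - xs) + inner (Q x) (Q x).
  rewrite (inner_proj_pythagoras A (x - xs)) projAperpB projAB.
  by rewrite (projAperp_id xsA) (projA_id0 xsA) subr0.
have h4 : inner (grad F x) (P x - xs) = inner (grad F x) (P x - x) - inner (grad F x) (xs - x).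
  by rewrite -innerBr opprB addrA subrK.
have h5 : inner (P x - x) (P x - x) = inner (Q x) (Q x).
  by rewrite -dx -(opprB x) innerNl innerNr opprK.
move: h1 h2; rewrite -/F enorm_sqr h3 h5 => h1 h2.
have qq := inner_ge0 (Q x).
(* The gradient is taken at [x] but the gap is wanted at [P x]: strong convexity leads from [x] to
   [xs], [descent_objective] from [x] to [P x] at the price of L |Q x|^2. The strong convexity term
   in [Q x] is dropped. *)
have h6 : F (P x) - F xs + mu / 2 * inner (P x - xs) (P x - xs) - L * inner (Q x) (Q x)
    <= inner (grad F x) (P x - xs).
  have : 0 <= mu / 2 * inner (Q x) (Q x) by rewrite mulr_ge0 // divr_ge0.
  rewrite h4; lra.
have := ler_wpM2l eta0 h6; lra.
Qed.

(** In the cross term with [Q x], the part of the gradient that differs from its value at [xs] is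
    treated pointwise by Young's inequality, while the part at [xs] stays linear until it is
    averaged. Thus [n] multiplies the squared norm of [grad F xs] but not [srange2]. *)
Lemma mean_range_step eta (n : R) x : 0 <= eta -> 1 <= n ->
  mean_le D (fun z => inner (Q (x - eta *: g z x)) (Q (x - eta *: g z x)))
   ((1 + (2 * n)^-1) * inner (Q x) (Q x)
    + 11 * n * eta ^+ 2 * (L ^+ 2 * inner (Q x) (Q x) + 4 * L * (F (P x) - F xs))
    + 4 * eta ^+ 2 * (srange2 + n * inner (grad F xs) (grad F xs))).
Proof.
move=> eta0 n1.
have n0 : 0 < n by exact: lt_le_trans n1.
exists (fun z => (1 + (4 * n)^-1) * inner (Q x) (Q x) - 2 * eta * inner (g z xs) (Q x)
  + (8 * n + 3) * eta ^+ 2 * (L ^+ 2 * inner (Q x) (Q x) + 4 * L * bregman z (P x))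
  + 3 * eta ^+ 2 * inner (Q (g z xs)) (Q (g z xs))).
exists ((1 + (4 * n)^-1) * inner (Q x) (Q x) - 2 * eta * inner (grad F xs) (Q x)
  + (8 * n + 3) * eta ^+ 2 * (L ^+ 2 * inner (Q x) (Q x) + 4 * L * (F (P x) - F xs))
  + 3 * eta ^+ 2 * srange2).
split.
- apply: has_meanD; last by apply: has_meanZ; exact: has_mean_range.
  apply: has_meanD.
    by apply: has_meanB; [exact: has_mean_cst|apply: has_meanZ; exact: has_mean_grad].
  apply: has_meanZ; apply: has_meanD; first exact: has_mean_cst.
  by apply: has_meanZ; exact: has_mean_bregman.
- move=> z; rewrite projAB projAZ.
  have hy : inner (Q (g z x)) (Q x) = inner (g z x) (Q x).
    rewrite -[in RHS](projA_add A (g z x)) innerDl (innerC (P _)) inner_projA_perp.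
    by rewrite add0r.
  rewrite inner_sqBZ hy.
  have q3 : inner (Q (g z x)) (Q (g z x)) <= 3 * (L ^+ 2 * inner (Q x) (Q x)
      + 4 * L * bregman z (P x) + inner (Q (g z xs)) (Q (g z xs))).
    rewrite {1 2}(grad_split z x) (projAD _ (_ + _)) (projAD _ (_ - _)).
    apply: le_trans (inner_sqD3 _ _ _) _.
    rewrite ler_pM2l // !lerD //.
      exact: le_trans (inner_projA_le _ _) (grad_drift _ _).
    exact: le_trans (inner_projA_le _ _) (grad_coco _ _).
  pose w := (g z x - g z (P x)) + (g z (P x) - g z xs).
  have w2 : inner w w <= 2 * (L ^+ 2 * inner (Q x) (Q x) + 4 * L * bregman z (P x)).
    apply: le_trans (inner_sqD2 _ _) _; rewrite ler_pM2l // lerD //.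
  have gw : inner (g z x) (Q x) = inner w (Q x) + inner (g z xs) (Q x).
    by rewrite (grad_split z x) -/w innerDl.
  have y1 := @inner_young _ _ (4 * n) (- eta *: w) (Q x).
  have {y1} : 2 * inner (- eta *: w) (Q x) <=
      4 * n * inner (- eta *: w) (- eta *: w) + (4 * n)^-1 * inner (Q x) (Q x).
    by apply: y1; rewrite mulr_gt0.
  rewrite !(innerZl, innerZr) => y1.
  have e2 : 0 <= eta ^+ 2 by exact: sqr_ge0.
  have := ler_wpM2l e2 q3.
  have : 4 * n * eta ^+ 2 * inner w w <=
     4 * n * eta ^+ 2 * (2 * (L ^+ 2 * inner (Q x) (Q x) + 4 * L * bregman z (P x))).
    by rewrite ler_wpM2l // !mulr_ge0 // ltW.
  move: y1; rewrite gw; lra.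
(* The second use of Young's inequality, now on the mean. Each use costs [(4 * n)^-1], together
   [(2 * n)^-1]; [8 * n + 3 <= 11 * n] as [1 <= n]. *)
have y1 := @inner_young _ _ (4 * n) (- eta *: grad F xs) (Q x).
have {y1} : 2 * inner (- eta *: grad F xs) (Q x) <=
    4 * n * inner (- eta *: grad F xs) (- eta *: grad F xs) + (4 * n)^-1 * inner (Q x) (Q x).
  by apply: y1; rewrite mulr_gt0.
rewrite !(innerZl, innerZr) => y1.
have [xsA xsm] := xs_min.
have G0 : 0 <= F (P x) - F xs by rewrite subr_ge0; apply: xsm; exact: projAperp_in.
have b0 : 0 <= eta ^+ 2 * (L ^+ 2 * inner (Q x) (Q x) + 4 * L * (F (P x) - F xs)).
  by rewrite mulr_ge0 ?sqr_ge0 // addr_ge0 // !mulr_ge0 ?sqr_ge0 ?inner_ge0 ?L_ge0.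
have s0 : 0 <= eta ^+ 2 * srange2.
  rewrite mulr_ge0 ?sqr_ge0 //.
  by apply: (has_mean_le (has_mean_cst D 0) has_mean_range) => z; exact: inner_ge0.
have -> : (2 * n)^-1 = (4 * n)^-1 + (4 * n)^-1 by field; rewrite lt0r_neq0.
have := ler_wpM2r b0 n1; lra.
Qed.

Definition lyapunov (c : R) x : R := inner (P x - xs) (P x - xs) + c * inner (Q x) (Q x).

Definition sgd_step (eta : R) (b : bool) x z : 'cV[R]_p :=
  let y := x - eta *: g z x in if b then P y else y.

(* [k] is the number of steps since the last projection. The weight decreases by
   [6 eta L] at each step, which pays both for the growth of the drift [Q x] and for the
   [L |Q x|^2] lost in the descent of [P x]; it is still at least [6 eta L] when
   [k <= E - 1], and the truncated subtraction makes it 0 at [k = E]. *)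
Definition drift_weight (eta : R) (E k : nat) : R := 6 * eta * L * (E - k)%:R.

(** If the step projects, or if the new weight is 0 because [k.+1 = E], no drift term remains and
    [mean_perp_step] suffices: the old weight, at least [6 * eta * L], pays for its drift. Otherwise
    [E >= 2], and [mean_range_step] is added with [n = E - 1]. *)
Lemma lyapunov_step (eta : R) (E k : nat) (b : bool) x :
  0 <= eta -> eta * (L * (E%:R + 9)) <= 1 -> eta * (mu + 25 * L * (E%:R - 1)) <= 1 ->
  (k < E)%N ->
  mean_le D (fun z => lyapunov (drift_weight eta E (if b then 0 else k.+1)) (sgd_step eta b x z))
    ((1 - mu * eta) * lyapunov (drift_weight eta E k) x
     - 3 / 10 * eta * (F (P x) - F xs)
     + (3 * eta ^+ 2 * sperp2
        + 24 * eta ^+ 3 * L * (E%:R - 1)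
          * (srange2 + (E%:R - 1) * inner (grad F xs) (grad F xs)))).
Proof.
move=> eta0 step1 step2 kE.
have [xsA xsm] := xs_min.
have G0 : 0 <= F (P x) - F xs by rewrite subr_ge0; apply: xsm; exact: projAperp_in.
have z0 : 0 <= inner (Q x) (Q x) := inner_ge0 _.
have sr0 : 0 <= srange2.
  by apply: (has_mean_le (has_mean_cst D 0) has_mean_range) => z; exact: inner_ge0.
have st0 : 0 <= inner (grad F xs) (grad F xs) := inner_ge0 _.
have muL := mu_le_L.
have L0 := L_ge0.
have q0 : 0 <= eta * L by rewrite mulr_ge0.
have mq : mu * eta <= eta * L by rewrite mulrC ler_wpM2l.
have mu_eta0 : 0 <= mu * eta by rewrite mulr_ge0.
have E1 : 1 <= E%:R :> R by rewrite ler1n (leq_trans _ kE).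
have q10 : 10 * (eta * L) <= 1.
  apply: le_trans step1; have : 0 <= eta * L * (E%:R - 1) by rewrite mulr_ge0 // subr_ge0.
  lra.
have Esub : (E - k)%:R = 1 + (E - k.+1)%:R :> R.
  by rewrite nat1r; congr (_%:R); rewrite subnSK.
have perp_only : mean_le D (fun z => inner (P (x - eta *: g z x) - xs) (P (x - eta *: g z x) - xs))
    ((1 - mu * eta) * lyapunov (drift_weight eta E k) x - 3 / 10 * eta * (F (P x) - F xs)
     + (3 * eta ^+ 2 * sperp2 + 24 * eta ^+ 3 * L * (E%:R - 1)
          * (srange2 + (E%:R - 1) * inner (grad F xs) (grad F xs)))).
  apply: mean_le_trans (mean_perp_step x eta0) _.
  have h1 : 0 <= 24 * eta ^+ 3 * L * (E%:R - 1)
      * (srange2 + (E%:R - 1) * inner (grad F xs) (grad F xs)).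
    have e1 : 0 <= E%:R - 1 :> R by rewrite subr_ge0.
    by rewrite !mulr_ge0 ?exprn_ge0 ?subr_ge0 // addr_ge0 // mulr_ge0.
  (* [eta * L <= 1 / 10] would leave 8/10 here; 3/10 is what survives in the case where the drift
     term remains. *)
  have h2 : 3 / 10 * eta * (F (P x) - F xs) <= (2 * eta - 12 * L * eta ^+ 2) * (F (P x) - F xs).
    by apply: ler_wpM2r => //; have := ler_wpM2l eta0 q10; lra.
  have h3 : (2 * eta * L + 3 * eta ^+ 2 * L ^+ 2) * inner (Q x) (Q x) <=
     (1 - mu * eta) * (drift_weight eta E k * inner (Q x) (Q x)).
    rewrite [leRHS]mulrA; apply: ler_wpM2r => //; rewrite /drift_weight Esub.
    have := ler_wpM2l q0 q10.
    have a0 : 0 <= (1 - mu * eta) * (eta * L * (E - k.+1)%:R).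
      by rewrite !mulr_ge0 // subr_ge0; lra.
    have : 9 / 10 * (eta * L) <= (1 - mu * eta) * (eta * L).
      by apply: ler_wpM2r => //; lra.
    lra.
  by rewrite /lyapunov mulrDr; lra.
have projected z : P (P (x - eta *: g z x)) = P (x - eta *: g z x).
  exact/projAperp_id/projAperp_in.
case: b => /=.
  rewrite /lyapunov /sgd_step.
  under eq_fun do rewrite projected (projA_id0 (projAperp_in A _)) inner0l mulr0 addr0.
  exact: perp_only.
have [kE1|kE1] := eqVneq k.+1 E.
  rewrite /lyapunov /sgd_step /drift_weight kE1 subnn.
  under eq_fun do rewrite mulr0 mul0r addr0.
  exact: perp_only.
pose n : R := E%:R - 1.
have E2 : (2 <= E)%N.
  by rewrite (@leq_ltn_trans k.+1) // ltn_neqAle kE1.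
have n1 : 1 <= n by rewrite /n lerBrDr (_ : 1 + 1 = 2%:R) // ler_nat.
set N : R := (E - k.+1)%:R in Esub.
have N0 : 0 <= N by [].
have Nn : N <= n.
  by rewrite /N /n lerBrDr natr1 ler_nat subnSK ?leq_subr.
have cE : drift_weight eta E k.+1 = 6 * (eta * L) * N by rewrite /drift_weight !mulrA.
have c0 : 0 <= drift_weight eta E k.+1 by rewrite cE !mulr_ge0.
have := mean_leD (mean_perp_step x eta0) (mean_leZ c0 (mean_range_step x eta0 n1)).
rewrite /sgd_step /lyapunov => /mean_le_trans; apply.
have ckE : drift_weight eta E k = 6 * (eta * L) * (N + 1).
  by rewrite /drift_weight Esub [1 + N]addrC !mulrA.
rewrite cE ckE.
have qn : 25 * (eta * L * n) <= 1.
  by apply: le_trans step2; rewrite /n; lra.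
set q := eta * L in q0 mq q10 qn *.
have qN : q * N <= q * n by rewrite ler_wpM2l.
have qN0 : 0 <= q * N by rewrite mulr_ge0.
have qn0 : 0 <= q * n by rewrite mulr_ge0 //; lra.
have qq : (q * N) * (q * n) <= 1 / 625.
  have : (q * N) * (q * n) <= (25^-1) * (25^-1) by apply: ler_pM => //; lra.
  lra.
(* This fixes the 6: in units of [q], Young's growth costs 3, the drift in [P x] at most 2 + 3/10,
   the term in [q ^+ 2] at most 66/625 and the contraction 12/25, in total less than 6. The 25 of
   the step bound enters as [q * n <= 1 / 25]. *)
have zcoef : 6 * q * N * (1 + (2 * n)^-1 + 11 * n * (q ^+ 2)) + 2 * q + 3 * q ^+ 2
    <= (1 - mu * eta) * (6 * q * (N + 1)).
  have n0 : 0 < n by exact: lt_le_trans n1.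
  have t1 : q * N * (2 * n)^-1 <= q / 2.
    rewrite ler_pdivrMr ?mulr_gt0 //.
    have -> : q / 2 * (2 * n) = q * n by field.
    exact: qN.
  have t2 : q * ((q * N) * (q * n)) <= q * (1 / 625) by rewrite ler_wpM2l.
  have t3 : q * (10 * q) <= q by rewrite ler_piMr.
  have t4 : mu * eta * (q * (N + 1)) <= q * (2 / 25).
    apply: ler_pM => //; first by rewrite mulr_ge0 // addr_ge0.
    rewrite mulrDr mulr1; have : q <= q * n by rewrite ler_peMr.
    lra.
  rewrite expr2; lra.
(* At most 264/625 + 12/10 < 17/10, so 3/10 of the descent [2 * eta] is left. *)
have gcoef : 6 * q * N * (44 * n * eta * q) + 12 * q * eta <= 17 / 10 * eta.
  have t1 : eta * ((q * N) * (q * n)) <= eta * (1 / 625) by rewrite ler_wpM2l.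
  have t2 : eta * (10 * q) <= eta by rewrite ler_piMr.
  lra.
have noise : 6 * q * N * (4 * eta ^+ 2) <= 24 * eta ^+ 3 * L * n.
  have : eta ^+ 2 * (q * N) <= eta ^+ 2 * (q * n) by rewrite ler_wpM2l ?sqr_ge0.
  rewrite /q !exprS; lra.
have Z1 := ler_wpM2r z0 zcoef.
have G1 := ler_wpM2r G0 gcoef.
have S0 : 0 <= srange2 + n * inner (grad F xs) (grad F xs).
  by rewrite addr_ge0 // mulr_ge0 //; lra.
have S1 := ler_wpM2r S0 noise.
move: Z1 G1 S1; rewrite /q -/n.
set zz := inner (Q x) (Q x); set GG := _ - F xs; set SS := srange2 + _.
set YY := inner (P x - xs) _; set ni := (2 * n)^-1.
rewrite !exprS !expr0; lra.
Qed.

(** Jensen's inequality, from the tangent at the average [y], whose linear terms cancel in the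
    weighted sum. [P] is linear, so [y] is the average of the [P (x j)]. *)
Lemma objective_average T (w : 'I_T -> R) (x : 'I_T -> 'cV[R]_p) :
  (forall j, 0 <= w j) -> 0 < \sum_j w j ->
  F (P ((\sum_j w j)^-1 *: \sum_j w j *: x j)) - F xs <=
  (\sum_j w j)^-1 * \sum_j w j * (F (P (x j)) - F xs).
Proof.
move=> w0 W0; set W := \sum_j w j in W0 *.
set y := P _.
have yE : W *: y = \sum_j w j *: P (x j).
  rewrite /y projAperpZ scalerA divff ?scale1r ?lt0r_neq0 //.
  elim/big_rec2 : _ => [|j u v _ <-]; last by rewrite projAperpD projAperpZ.
  by rewrite projAperp_id ?/in_Aperp ?mulmx0.
rewrite -(ler_pM2l W0) mulrA divff ?lt0r_neq0 // mul1r.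
rewrite /W mulr_suml.
have : \sum_j w j * (F y - F xs + inner (grad F y) (P (x j) - y)) <=
       \sum_j w j * (F (P (x j)) - F xs).
  apply: ler_sum => j _; rewrite ler_wpM2l //.
  by have := objective_convex y (P (x j)); lra.
under eq_bigr do rewrite mulrDr; rewrite big_split /=.
suff -> : \sum_j w j * inner (grad F y) (P (x j) - y) = 0 by rewrite addr0.
have : inner (grad F y) (\sum_j w j *: P (x j) - W *: y) = 0 by rewrite yE subrr inner0r.
rewrite innerBr innerZr /W mulr_suml => h; rewrite -[RHS]h.
under eq_bigr do rewrite innerBr mulrBr.
rewrite sumrB; congr (_ - _).
elim/big_rec2 : _ => [|j u v _ ->]; first by rewrite inner0r.
by rewrite innerDr innerZr.
Qed.

End OneStep.

(** * The filtration of the samples *)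

Section Filtration.
Context {R : realType} {p : nat} {d d' : measure_display}.
Context {Xi : measurableType d} {Omega : measurableType d'}.
Variables (D : probability Xi R) (Pr : probability Omega R).
Variables (x0 : Omega -> 'cV[R]_p) (xi : nat -> Omega -> Xi).
Hypothesis iid : iid_sample D Pr x0 xi.

(** The pi-system on which [iid_sample] states independence; it generates the sigma-algebra of the
    past before [xi t]. *)
Definition cylinder (t : nat) : set (set Omega) :=
  [set X | exists B S, [/\ borel_vec B, forall i, measurable (S i) &
    X = x0 @^-1` B `&` \bigcap_(i < t) (xi i @^-1` S i)]].

Let borel_vecT : @borel_vec R p setT.
Proof. by apply: sub_sigma_algebra; exact: openT. Qed.

Lemma cylinder_setT t : cylinder t setT.
Proof.
exists setT, (fun=> setT); split => //.
by rewrite preimage_setT setTI; apply/seteqP; split.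
Qed.

Lemma cylinder_setI t : setI_closed (cylinder t).
Proof.
move=> _ _ [B [S [bB mS ->]]] [B' [S' [bB' mS' ->]]].
exists (B `&` B'), (fun i => S i `&` S' i); split => [|i|].
- exact: (@measurableI _ (g_sigma_algebraType [set U : set 'cV[R]_p | open U])).
- exact: measurableI.
- rewrite setIACA -preimage_setI; congr (_ `&` _).
  by rewrite -bigcapI.
Qed.

Lemma cylinder_measurable t : cylinder t `<=` measurable.
Proof.
have [m0 mxi _ _] := iid.
move=> _ [B [S [bB mS ->]]]; apply: measurableI; first exact: m0.
by apply: bigcap_measurableType => i _; rewrite -[_ @^-1` _]setTI; exact: mxi.
Qed.

(** The intersection is a rectangle with one more factor, so the product rule applies at [t] and at
    [t.+1]. *)
Lemma cylinder_indep t X S : cylinder t X -> measurable S ->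
  (Pr (X `&` xi t @^-1` S) = Pr X * D S)%E.
Proof.
have [_ _ law ind] := iid.
move=> [B [S' [bB mS' ->]]] mS.
pose S2 i := if i == t then S else S' i.
have mS2 i : measurable (S2 i) by rewrite /S2; case: ifP.
have E : x0 @^-1` B `&` \bigcap_(i < t) (xi i @^-1` S' i) `&` xi t @^-1` S =
   x0 @^-1` B `&` \bigcap_(i < t.+1) (xi i @^-1` S2 i).
  apply/seteqP; split => w.
    move=> [[wB wS'] wS]; split => // i; rewrite /= ltnS leq_eqVlt => /orP[/eqP ->|it].
      by rewrite /S2 eqxx.
    by rewrite /S2 (ltn_eqF it); exact: wS'.
  move=> [wB wS2]; split; first split => //.
    by move=> i it; have := wS2 i (ltnW it); rewrite /S2 (ltn_eqF it).
  by have := wS2 t (ltnSn t); rewrite /S2 eqxx.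
rewrite E ind // ind // big_ord_recr /= {2}/S2 eqxx law // muleA.
congr (_ * _ * _)%E; apply: eq_bigr => i _.
by rewrite /S2 (ltn_eqF (ltn_ord i)).
Qed.

Lemma cylinderS t : <<s cylinder t >> `<=` <<s cylinder t.+1 >>.
Proof.
apply: sub_sigma_algebra2 => _ [B [S [bB mS ->]]].
exists B, (fun i => if (i < t)%N then S i else setT); split => // [i|].
  by case: ifP.
congr (_ `&` _); apply/seteqP; split => w h i it; last first.
  by have := h i (ltnW it); rewrite it.
by case: ifP => // /h.
Qed.

Lemma measurable_cylinderS t (h : Omega -> R) :
  measurable_fun setT (h : g_sigma_algebraType (cylinder t) -> R) ->
  measurable_fun setT (h : g_sigma_algebraType (cylinder t.+1) -> R).
Proof. by move=> mh _ Y mY; apply: cylinderS; exact: mh. Qed.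

Lemma measurable_cylinder t (h : Omega -> R) :
  measurable_fun setT (h : g_sigma_algebraType (cylinder t) -> R) ->
  measurable_fun setT h.
Proof.
move=> mh _ Y mY; have : <<s cylinder t >> (setT `&` h @^-1` Y) by exact: mh.
by apply: smallest_sub; [exact: sigma_algebra_measurable|exact: cylinder_measurable].
Qed.

Lemma measurable_cylinder_init i :
  measurable_fun setT ((fun w => x0 w i 0) : g_sigma_algebraType (cylinder 0) -> R).
Proof.
apply: (measurability _ (RGenOpens.measurableE R)) => _ [_ [a [b ->]] <-].
rewrite setTI; apply: sub_sigma_algebra.
exists ((fun v : 'cV[R]_p => v i 0) @^-1` `]a, b[%classic), (fun=> setT); split => //.
  apply: sub_sigma_algebra => /=.
  apply: open_comp; last exact: interval_open.
  by move=> v _; exact: coord_continuous.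
by rewrite (_ : \bigcap_(_ < _) _ = setT) ?setIT //; apply/seteqP; split.
Qed.

Lemma measurable_cylinder_sample t :
  measurable_fun setT (xi t : g_sigma_algebraType (cylinder t.+1) -> Xi).
Proof.
move=> _ S mS; rewrite setTI; apply: sub_sigma_algebra.
exists setT, (fun i => if i == t then S else setT); split => // [i|].
  by case: ifP.
rewrite preimage_setT setTI; apply/seteqP; split => w.
  by move=> wS i _ /=; case: eqP => // ->.
by move=> /(_ t (ltnSn t)); rewrite eqxx.
Qed.

End Filtration.

(** * Projection times *)

Section ProjectionGaps.
Local Open Scope nat_scope.

(** Time 0 counts as a projection, in accordance with [x0] lying in R(A^perp). *)
Fixpoint since_projection (I : pred nat) (t : nat) : nat :=
  if t is s.+1 then (if I s.+1 then 0 else (since_projection I s).+1) else 0.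

(* [b] is the last element of [J] up to [a]. *)
Lemma since_projection_lt_max (J : pred nat) n a b :
  b <= a -> since_projection J a = a - b -> J (a + n) -> forall t, a <= t < a + n ->
  since_projection J t < \max_(d <- pairmap (fun s t => t - s) b [seq t <- iota a.+1 n | J t]) d.
Proof.
elim: n a b => [|n IH] a b ba ka Jn t; first by rewrite addn0 leqNgt andNb.
rewrite /=; case: ifPn => Ja.
  (* At [t = a] the count [a - b] is below the difference [a.+1 - b] that ends here; for later [t]
     the induction restarts with [a.+1] as last element. *)
  rewrite /= big_cons; have [->|ta] := eqVneq t a.
    by move=> _; rewrite leq_max ka -subSn // leqnn.
  move=> /andP[at_ tn]; rewrite leq_max; apply/orP; right.
  apply: IH => //; first by rewrite /= Ja subnn.
    by rewrite addSnnS.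
  by rewrite addSnnS tn andbT ltn_neqAle eq_sym ta.
have n0 : 0 < n.
  by case: n Jn {IH} => // ; rewrite addn1 (negPf Ja).
have ka1 : since_projection J a.+1 = a.+1 - b by rewrite /= (negPf Ja) ka subSn.
have IH' := IH a.+1 b (leqW ba) ka1; rewrite addSnnS in IH'.
have [->|ta] := eqVneq t a.
  move=> _; apply: ltn_trans (IH' Jn a.+1 _).
    by rewrite /= (negPf Ja).
  by rewrite leqnn /= -addn2 leq_add2l; case: n n0 Jn {IH IH'}.
move=> /andP[at_ tn]; apply: IH' => //.
by rewrite tn andbT ltn_neqAle eq_sym ta.
Qed.

(** Adding 0 and [T] to the projection times changes no count before [T], and [T] closes the last
    block, so each [t < T] lies inside a block. *)
Lemma since_projection_gap T (I : pred nat) t : t < T -> since_projection I t < gap T I.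
Proof.
move=> tT; pose J s := [|| s == 0, s == T | I s].
have -> : since_projection I t = since_projection J t.
  elim: t tT => //= t IH tT; rewrite IH ?(ltn_trans _ tT) //.
  by rewrite /J /= (ltn_eqF tT).
rewrite /gap /projection_times /= big_cons.
rewrite leq_max; apply/orP; right.
by apply: (@since_projection_lt_max J T 0 0) => //; rewrite /J add0n eqxx orbT.
Qed.

End ProjectionGaps.

(** * Expectations along the iterates *)

Section Dynamics.
Context {R : realType} {p m : nat} {d d' : measure_display}.
Context {Xi : measurableType d} {Omega : measurableType d'}.
Variables (A : 'M[R]_(p, m)) (D : probability Xi R) (Pr : probability Omega R).
Variables (f : 'cV[R]_p -> Xi -> R) (L mu : R) (xs : 'cV[R]_p).
Variables (x0 : Omega -> 'cV[R]_p) (xi : nat -> Omega -> Xi) (I : pred nat) (T E : nat).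
Let F := objective D f.
Local Notation P := (projAperp A).
Local Notation Q := (projA A).
Hypothesis nontrivial : exists x : 'cV[R]_p, x != 0 /\ in_Aperp A x.
Hypothesis f_int : forall x, D.-integrable setT (EFin \o f x).
Hypothesis f_diff : forall z x, differentiable (f ^~ z) x.
Hypothesis f_convex : forall z, convex_function setT (f ^~ z).
Hypothesis f_lip : forall z, lipschitz_grad L (f ^~ z).
Hypothesis f_grad : gradient_mean D f.
Hypothesis mu_ge0 : 0 <= mu.
Hypothesis F_strong : strongly_convex mu F.
Hypothesis xs_min : constrained_min A F xs.
Hypothesis perp_fin : noise_perp D f A xs \is a fin_num.
Hypothesis range_fin : noise_range D f A xs \is a fin_num.
Hypothesis iid : iid_sample D Pr x0 xi.
Hypothesis x0_in : forall w, in_Aperp A (x0 w).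
Hypothesis init_fin : init_dist Pr A x0 xs \is a fin_num.
Hypothesis gapE : gap T I = E.

Let Delta2 := fine (init_dist Pr A x0 xs).
Let sperp2 := fine (noise_perp D f A xs).
Let stilde2 := fine (noise_range D f A xs) + (E%:R - 1) * enorm (grad F xs) ^+ 2.

Let L0 : 0 <= L. Proof. exact: (L_ge0 nontrivial f_lip). Qed.

Lemma grad_seq_continuous z i (u : nat -> 'cV[R]_p) (x : 'cV[R]_p) :
  (forall j, u n j 0 @[n --> \oo] --> x j 0) ->
  grad (f ^~ z) (u n) i 0 @[n --> \oo] --> grad (f ^~ z) x i 0.
Proof.
move=> ux; apply/cvgrPdist_le => /= e e0.
have h : L ^+ 2 * inner (u n - x) (u n - x) @[n --> \oo] --> 0.
  rewrite -(mulr0 (L ^+ 2)); apply: cvgM; first exact: cvg_cst.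
  have -> : (0 : R) = \sum_(j < p) (x j 0 - x j 0) * (x j 0 - x j 0).
    by rewrite big1 // => j _; rewrite subrr mul0r.
  rewrite (_ : (fun n => inner (u n - x) (u n - x)) =
    (fun n => \sum_(j < p) (u n j 0 - x j 0) * (u n j 0 - x j 0))); last first.
    by apply/funext => n; rewrite innerE; apply: eq_bigr => j _; rewrite !mxE.
  apply: (cvg_sumr (u := fun j n => (u n j 0 - x j 0) * (u n j 0 - x j 0))) => j.
  by apply: cvgM; apply: cvgB => //; exact: cvg_cst.
have e2 : 0 < e ^+ 2 by rewrite exprn_gt0.
have /cvgrPdist_le/(_ _ e2) := h; apply: filterS => n /=.
rewrite sub0r normrN => hn; rewrite distrC.
rewrite -ler_sqr ?nnegrE ?normr_ge0 ?(ltW e0) // real_normK ?num_real //.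
apply: le_trans _ (le_trans (ler_norm _) hn).
apply: le_trans _ (lipschitz_inner (f_lip z) x (u n)).
rewrite innerE (bigD1 i) //= !mxE -expr2 lerDl.
by apply: sumr_ge0 => j _; rewrite -expr2 sqr_ge0.
Qed.

Lemma objective_seq_continuous (u : nat -> 'cV[R]_p) (x : 'cV[R]_p) :
  (forall j, u n j 0 @[n --> \oo] --> x j 0) -> F (u n) @[n --> \oo] --> F x.
Proof.
move=> /cvg_col ux; apply: (cvg_comp _ _ ux).
by have [dF _] := f_grad x; exact: (differentiable_continuous dF).
Qed.

Section Measurability.
Context {d1 : measure_display} {T1 : measurableType d1}.
Variable H : T1 -> 'cV[R]_p.
Hypothesis mH : forall i, measurable_fun setT (fun t => H t i 0).

Lemma measurable_sgd_step eta b (zeta : T1 -> Xi) : measurable_fun setT zeta ->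
  forall i, measurable_fun setT (fun t => sgd_step A f eta b (H t) (zeta t) i 0).
Proof.
move=> mz.
have mg i : measurable_fun setT (fun t => grad (f ^~ (zeta t)) (H t) i 0).
  apply: (@measurable_caratheodory _ _ _ _ _ _ (fun x z => grad (f ^~ z) x i 0)) => //.
    by move=> z u x; exact: grad_seq_continuous.
  by move=> x; exact: measurable_grad f_grad x i.
have my i : measurable_fun setT (fun t => (H t - eta *: grad (f ^~ (zeta t)) (H t)) i 0).
  under eq_fun do rewrite !mxE.
  apply: measurable_funB => //; apply: measurable_funM => //.
  by have := mg i; under eq_fun do rewrite !mxE.
rewrite /sgd_step; case: b => //.
exact: measurable_fun_projAperp.
Qed.

Lemma measurable_lyapunov c : measurable_fun setT (fun t => lyapunov A xs c (H t)).
Proof.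
have mP := measurable_fun_projAperp A mH.
have mQ := measurable_fun_projA A mH.
rewrite /lyapunov; apply: measurable_funD; last first.
  by apply: measurable_funM => //; exact: measurable_fun_inner.
apply: measurable_fun_inner => i; under eq_fun do rewrite !mxE;
  apply: measurable_funB => //; by have := mP i; under eq_fun do rewrite !mxE.
Qed.

Lemma measurable_objective_gap : measurable_fun setT (fun t => F (P (H t)) - F xs).
Proof.
apply: measurable_funB => //.
apply: (@measurable_caratheodory _ _ _ _ T1 _ (fun x _ => F x) (fun t => P (H t)) id) => //.
  by move=> _ u x; exact: objective_seq_continuous.
exact: measurable_fun_projAperp.
Qed.

End Measurability.

Variable eta : R.
Let X t w := dpsgd A f I (fun=> eta) (x0 w) (xi ^~ w) t.

(** Adaptedness: independence of [xi t] is available only from this smaller sigma-algebra. *)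
Lemma measurable_iterate_cylinder t i :
  measurable_fun setT ((fun w => X t w i 0) : g_sigma_algebraType (cylinder x0 xi t) -> R).
Proof.
elim: t i => [|t IH] i; first exact: measurable_cylinder_init.
apply: (@measurable_sgd_step _ (g_sigma_algebraType (cylinder x0 xi t.+1)) (X t) _
  eta (I t.+1) (xi t)).
  by move=> j; apply: measurable_cylinderS; exact: IH.
exact: measurable_cylinder_sample.
Qed.

Lemma measurable_iterate t i : measurable_fun setT (fun w => X t w i 0).
Proof. by apply: (measurable_cylinder iid); exact: measurable_iterate_cylinder. Qed.

Lemma measurable_output_gap : measurable_fun setT
  (fun w => F (dpsgd_output A f I mu eta T (x0 w) (xi ^~ w)) - F xs).
Proof.
apply: measurable_objective_gap => i.
under eq_fun do rewrite mxE summxE.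
apply: measurable_funM => //; apply: measurable_sum => j.
under eq_fun do rewrite mxE.
by apply: measurable_funM => //; exact: measurable_iterate.
Qed.

Lemma lyapunov_ge0 c x : 0 <= c -> 0 <= lyapunov A xs c x.
Proof. by move=> c0; rewrite addr_ge0 ?mulr_ge0 ?inner_ge0. Qed.

Lemma objective_gap_ge0 x : 0 <= F (P x) - F xs.
Proof. by have [_ xsm] := xs_min; rewrite subr_ge0; apply: xsm; exact: projAperp_in. Qed.

(** For the degenerate cases [L = 0] and [eta = 0], where the error is bounded outcome by
    outcome. *)
Lemma expected_error_pointwise b :
  (forall w, F (dpsgd_output A f I mu eta T (x0 w) (xi ^~ w)) - F xs
    <= b * enorm (P (x0 w) - xs) ^+ 2) -> 0 <= b ->
  (expected_error D Pr f A I mu eta T x0 xi xs <= (b * Delta2)%:E)%E.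
Proof.
move=> hb b0; rewrite /expected_error expectation.unlock; apply: mean_le_integral.
- exact: measurable_output_gap.
- by move=> w; exact: objective_gap_ge0.
- exists (fun w => b * enorm (P (x0 w) - xs) ^+ 2), (b * Delta2); split => //.
  apply/has_meanZ/ge0_has_mean_fine => //.
    under eq_fun do rewrite enorm_sqr.
    apply: measurable_fun_inner => i; under eq_fun do rewrite !mxE;
      apply: measurable_funB => //;
      have := measurable_fun_projAperp A (fun i => @measurable_iterate 0 i) i;
      by under eq_fun do rewrite !mxE.
  by move=> w; exact: sqr_ge0.
Qed.

Lemma objective_gap_le x : F (P x) - F xs <= L * inner (P x - xs) (P x - xs).
Proof.
have [xsA _] := xs_min.
have := descent_objective nontrivial f_int f_diff f_convex f_lip f_grad xs (P x).
rewrite -/F (grad_min_orthogonal nontrivial f_int f_diff f_convex f_lip f_grad xs_min); last first.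
  by apply: in_AperpB => //; exact: projAperp_in.
by rewrite addr0 lerBlDl.
Qed.

Lemma expected_error_L0 : L = 0 ->
  (expected_error D Pr f A I mu eta T x0 xi xs <= 0)%E.
Proof.
move=> L00; rewrite -[leRHS](mul0e Delta2%:E) -EFinM; apply: expected_error_pointwise => // w.
rewrite mul0r; apply: le_trans (objective_gap_le _) _.
by rewrite L00 mul0r.
Qed.

Lemma expected_error_eta0 : eta = 0 -> (0 < T)%N ->
  (expected_error D Pr f A I mu eta T x0 xi xs <= (L * Delta2)%:E)%E.
Proof.
move=> e0 T0; apply: expected_error_pointwise => // w.
have XE t : dpsgd A f I (fun=> eta) (x0 w) (xi ^~ w) t = x0 w.
  elim: t => //= t ->; rewrite e0 scale0r subr0.
  by case: (I t.+1) => //; exact: projAperp_id.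
have -> : dpsgd_output A f I mu eta T (x0 w) (xi^~ w) = P (x0 w).
  rewrite /dpsgd_output; congr projAperp.
  under [X in _ *: X]eq_bigr do rewrite XE.
  rewrite -scaler_suml scalerA mulVf ?scale1r //.
  rewrite /weight e0 mulr0 subr0; under eq_bigr do rewrite expr1n.
  by rewrite sumr_const card_ord pnatr_eq0 -lt0n.
by rewrite enorm_sqr; exact: objective_gap_le.
Qed.

Hypothesis eta_gt0 : 0 < eta.
Hypothesis step1 : eta * (L * (E%:R + 9)) <= 1.
Hypothesis step2 : eta * (mu + 25 * L * (E%:R - 1)) <= 1.

Let c k := drift_weight L eta E k.
Let c_ge0 k : 0 <= c k.
Proof. by rewrite /c /drift_weight !mulr_ge0 ?(ltW eta_gt0). Qed.
Let k t := since_projection I t.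
Let N := 3 * eta ^+ 2 * sperp2 + 24 * eta ^+ 3 * L * (E%:R - 1) * stilde2.
Let V t := (\int[Pr]_w (lyapunov A xs (c (k t)) (X t w))%:E)%E.
Let G t := (\int[Pr]_w (F (P (X t w)) - F xs)%:E)%E.

Lemma noise_perp_ge0 : 0 <= sperp2.
Proof. by apply/fine_ge0/expectation_ge0 => z; exact: sqr_ge0. Qed.

Lemma noise_tilde_ge0 : (1 <= E)%N -> 0 <= stilde2.
Proof.
move=> E1; apply: addr_ge0; last by rewrite mulr_ge0 ?sqr_ge0 // subr_ge0 ler1n.
by apply/fine_ge0/expectation_ge0 => z; exact: sqr_ge0.
Qed.

Lemma N_ge0 : (1 <= E)%N -> 0 <= N.
Proof.
move=> E1; have e0 := ltW eta_gt0.
by rewrite addr_ge0 // !mulr_ge0 ?exprn_ge0 ?noise_perp_ge0 ?noise_tilde_ge0 ?subr_ge0 ?ler1n.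
Qed.

(* Stated in [\bar R]: all terms are nonnegative, so no integrability of the iterates is
   needed beforehand, and finiteness of [V] and [G] follows by induction. *)
Lemma lyapunov_expectation_step t : (t < T)%N ->
  (V t.+1 + (3 / 10 * eta)%:E * G t <= (1 - mu * eta)%:E * V t + N%:E)%E.
Proof.
move=> tT.
have [_ mxi _ _] := iid.
have kE : (k t < E)%N by rewrite -gapE; exact: since_projection_gap.
set b := I t.+1.
pose phi (u : Omega * Xi) : \bar R :=
  (lyapunov A xs (c (k t.+1)) (sgd_step A f eta b (X t u.1) u.2))%:E.
have phi0 u : (0 <= phi u)%E by rewrite lee_fin lyapunov_ge0.
have mphi : measurable_fun [set: g_sigma_algebraType (cylinder x0 xi t) * Xi] phi.
  apply/measurable_EFinP; apply: measurable_lyapunov.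
  apply: measurable_sgd_step; last exact: measurable_snd.
  by move=> i; exact: (measurableT_comp (@measurable_iterate_cylinder t i) measurable_fst).
(* Measurability for the sigma-algebra of the past serves the independence argument; this version,
   for the full one, makes the inner integral a measurable function on [Omega]. *)
have mphi' : measurable_fun [set: Omega * Xi] phi.
  apply/measurable_EFinP; apply: measurable_lyapunov.
  apply: measurable_sgd_step; last exact: measurable_snd.
  move=> i; apply: (measurableT_comp (@measurable_iterate t i)).
  exact: measurable_fst.
have -> : V t.+1 = (\int[Pr]_w \int[D]_z phi (w, z))%E.
  exact: (integral_indep_sigma (cylinder_setT x0 xi t) (@cylinder_setI _ _ _ _ _ _ x0 xi t)
    (@cylinder_measurable _ _ _ _ _ _ _ _ _ _ iid t) (mxi t)
    (@cylinder_indep _ _ _ _ _ _ _ _ _ _ iid t) mphi phi0).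
have mG : measurable_fun setT (fun w => F (P (X t w)) - F xs).
  by apply: measurable_objective_gap => i; exact: measurable_iterate.
have mV : measurable_fun setT (fun w => lyapunov A xs (c (k t)) (X t w)).
  by apply: measurable_lyapunov => i; exact: measurable_iterate.
have e0 : 0 <= 3 / 10 * eta by rewrite mulr_ge0 // ltW.
have me0 : 0 <= 1 - mu * eta.
  rewrite subr_ge0 mulrC; apply: le_trans step2; rewrite ler_wpM2l ?(ltW eta_gt0) //.
  by rewrite lerDl !mulr_ge0 // subr_ge0 ler1n (leq_trans _ kE).
have step w := lyapunov_step nontrivial f_int f_diff f_convex f_lip f_grad mu_ge0 F_strong
  xs_min perp_fin range_fin b (X t w) (ltW eta_gt0) step1 step2 kE.
have gap0 w : 0 <= F (P (X t w)) - F xs := objective_gap_ge0 _.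
have lyap0 w : 0 <= lyapunov A xs (c (k t)) (X t w) by exact: lyapunov_ge0.
have GE : ((3 / 10 * eta)%:E * G t = \int[Pr]_w (3 / 10 * eta * (F (P (X t w)) - F xs))%:E)%E.
  under [RHS]eq_integral do rewrite EFinM.
  rewrite ge0_integralZl_EFin //; first by move=> w _; rewrite lee_fin.
  exact/measurable_EFinP.
have VE : ((1 - mu * eta)%:E * V t + N%:E =
    \int[Pr]_w ((1 - mu * eta) * lyapunov A xs (c (k t)) (X t w) + N)%:E)%E.
  under [RHS]eq_integral do rewrite EFinD EFinM.
  rewrite ge0_integralD //; last 2 first.
  - by apply/measurable_EFinP/measurable_funM.
  - by move=> w _; rewrite lee_fin N_ge0 // (leq_trans _ kE).
  rewrite ge0_integralZl_EFin //; last 2 first.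
  - by move=> w _; rewrite lee_fin.
  - exact/measurable_EFinP.
  by rewrite (has_mean_integral (has_mean_cst Pr N)).
  by move=> w _; rewrite -EFinM lee_fin mulr_ge0.
rewrite GE VE -ge0_integralD //; last 4 first.
- by move=> w _; exact: integral_ge0.
- exact: measurable_fun_fubini_tonelli_F.
- by move=> w _; rewrite lee_fin mulr_ge0.
- by apply/measurable_EFinP/measurable_funM.
apply: ge0_le_integral => //.
- move=> w _; apply: adde_ge0; last by rewrite lee_fin mulr_ge0.
  exact: integral_ge0.
- apply: emeasurable_funD; first exact: measurable_fun_fubini_tonelli_F.
  by apply/measurable_EFinP/measurable_funM.
- by apply/measurable_EFinP/measurable_funD => //; exact: measurable_funM.
(* For frozen [w] the gap is a real constant in [z]; moved to the right, it leaves the one-step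
   bound at [x = X t w]. *)
move=> w _; rewrite -leeBrDr // -EFinB.
have mw : measurable_fun setT (fun z => lyapunov A xs (c (k t.+1)) (sgd_step A f eta b (X t w) z)).
  by apply: measurable_lyapunov; exact: measurable_sgd_step.
apply: (mean_le_integral mw) => [z|]; first exact: lyapunov_ge0.
have := step w; congr mean_le.
by rewrite /N /stilde2 enorm_sqr addrAC.
Qed.
Let V0E : V 0 = Delta2%:E.
Proof.
rewrite /Delta2 fineK // /init_dist expectation.unlock; apply: eq_integral => w _.
by rewrite /lyapunov projA_id0 // inner0l mulr0 addr0 enorm_sqr.
Qed.

Let V_ge0 t : (0 <= V t)%E.
Proof. by apply: integral_ge0 => w _; rewrite lee_fin lyapunov_ge0. Qed.

Let G_ge0 t : (0 <= G t)%E.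
Proof. by apply: integral_ge0 => w _; rewrite lee_fin objective_gap_ge0. Qed.

Let V_fin t : (t <= T)%N -> V t \is a fin_num.
Proof.
elim: t => [|t IH] tT; first by rewrite V0E.
rewrite ge0_fin_numE //.
apply: le_lt_trans (le_trans _ (lyapunov_expectation_step tT)) _.
  by rewrite leeDl // mule_ge0 // lee_fin mulr_ge0 // ltW.
by rewrite -(fineK (IH (ltnW tT))) -EFinM -EFinD ltry.
Qed.

Let G_fin t : (t < T)%N -> G t \is a fin_num.
Proof.
move=> tT; rewrite ge0_fin_numE //.
have e0 : 0 < 3 / 10 * eta by rewrite mulr_gt0.
have : ((3 / 10 * eta)%:E * G t < +oo)%E.
  apply: le_lt_trans (le_trans _ (lyapunov_expectation_step tT)) _; first by rewrite leeDr.
  by rewrite -(fineK (V_fin (ltnW tT))) -EFinM -EFinD ltry.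
move: (G_ge0 t); case: (G t) => [r _ _| _ |//]; first by rewrite ltry.
by rewrite gt0_muley ?lte_fin.
Qed.

Lemma weighted_gap_sum t : (t <= T)%N ->
  3 / 10 * eta * (\sum_(j < t) weight mu eta t j * fine (G j))
  <= (1 - mu * eta) ^+ t * Delta2 + N * \sum_(j < t) weight mu eta t j.
Proof.
move=> tT.
(* The induction needs the current value of the Lyapunov function on the left; it is dropped only at
   the end. *)
suff : 3 / 10 * eta * (\sum_(j < t) weight mu eta t j * fine (G j)) + fine (V t)
  <= (1 - mu * eta) ^+ t * Delta2 + N * \sum_(j < t) weight mu eta t j.
  by apply: le_trans; rewrite lerDl fine_ge0.
elim: t tT => [|t IH] tT.
  by rewrite !big_ord0 mulr0 add0r mulr0 addr0 expr0 mul1r V0E.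
have wS j : (j < t)%N -> weight mu eta t.+1 j = (1 - mu * eta) * weight mu eta t j.
  by move=> jt; rewrite /weight -exprS; congr (_ ^+ _); rewrite -!subnDA !addn1 subSn.
have me0 : 0 <= 1 - mu * eta.
  rewrite subr_ge0 mulrC; apply: le_trans step2; rewrite ler_wpM2l ?(ltW eta_gt0) //.
  by rewrite lerDl !mulr_ge0 // subr_ge0 ler1n -gapE (leq_trans _ (since_projection_gap I tT)).
rewrite !big_ord_recr /=.
under eq_bigr do rewrite wS // -mulrA.
under [X in _ <= _ + _ * (X + _)]eq_bigr do rewrite wS //.
rewrite -!mulr_sumr /weight subSnn subnn expr0 mul1r exprS.
have := lyapunov_expectation_step tT.
rewrite -(fineK (V_fin tT)) -(fineK (V_fin (ltnW tT))) -(fineK (G_fin tT)) -!EFinM -!EFinD lee_fin.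
have := ler_wpM2l me0 (IH (ltnW tT)); lra.
Qed.

(** Dividing by [3 / 10 * eta] turns the factors 1, 3 and 24 into 10/3, 10 and 80; the largest
    serves for all. *)
Lemma expected_error_le : (0 < T)%N ->
  (expected_error D Pr f A I mu eta T x0 xi xs <=
    (80 * (Num.min T%:R^-1 ((1 - mu * eta) ^+ T) * (Delta2 / eta) + eta * sperp2
       + (E%:R - 1) * L * eta ^+ 2 * stilde2))%:E)%E.
Proof.
move=> T0.
have E1 : (1 <= E)%N by rewrite -gapE (leq_trans _ (since_projection_gap I T0)).
pose a : R := 1 - mu * eta.
have muL : mu <= L := mu_le_L nontrivial f_lip f_grad F_strong.
have eta0 := ltW eta_gt0.
have mu_eta0 : 0 <= mu * eta by rewrite mulr_ge0.
have a_gt0 : 0 < a.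
  have h1 : mu * eta <= eta * L by rewrite mulrC ler_wpM2l.
  have h2 : 0 <= eta * L * (E%:R - 1) by rewrite !mulr_ge0 // subr_ge0 ler1n.
  have := step1; rewrite /a; lra.
have a1 : a <= 1 by rewrite gerBl.
have a0 := ltW a_gt0.
set W := \sum_(j < T) weight mu eta T j.
set S := \sum_(j < T) weight mu eta T j * fine (G j).
have w0 (j : 'I_T) : 0 <= weight mu eta T j by rewrite /weight exprn_ge0.
(* The weight of [j = T - 1] is 1, and every weight is at least [a ^+ T]. These two lower bounds on
   [W] give the two sides of the minimum. *)
have W1 : 1 <= W.
  rewrite /W; case: (T) T0 w0 => // n _ w0; rewrite big_ord_recr /=.
  rewrite {2}/weight subSnn subnn expr0 lerDr; apply: sumr_ge0 => j _.
  exact: (w0 (widen_ord (leqnSn n) j)).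
have WT : T%:R * a ^+ T <= W.
  rewrite mulr_natl -[X in _ *+ X]card_ord -sumr_const; apply: ler_sum => j _.
  by rewrite /weight -/a ler_wiXn2l // (leq_trans (leq_subr _ _)) ?leq_subr.
have W0 : 0 < W by exact: lt_le_trans W1.
have err : (expected_error D Pr f A I mu eta T x0 xi xs <= (W^-1 * S)%:E)%E.
  rewrite /expected_error expectation.unlock; apply: mean_le_integral.
  - exact: measurable_output_gap.
  - by move=> w; exact: objective_gap_ge0.
  - exists (fun w => W^-1 * \sum_(j < T) weight mu eta T j * (F (P (X j w)) - F xs)), (W^-1 * S).
    split => //.
    + apply: has_meanZ; apply: has_mean_sum => j; apply: has_meanZ.
      have mG : measurable_fun setT (fun w => F (P (X j w)) - F xs).
        by apply: measurable_objective_gap => i; exact: measurable_iterate.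
      have := ge0_has_mean_fine (D := Pr) mG (fun w => objective_gap_ge0 _).
      by rewrite expectation.unlock; apply; exact: G_fin.
    + move=> w; exact: (objective_average A xs f_int f_diff f_convex f_grad
        (w := fun j : 'I_T => weight mu eta T j) (fun j : 'I_T => X j w) w0 W0).
apply: le_trans err _; rewrite lee_fin.
have D0 : 0 <= Delta2 by rewrite -lee_fin -V0E.
have sum := weighted_gap_sum (leqnn T); rewrite -/W -/S -/a in sum.
set M := Num.min _ _.
have WM : a ^+ T / W <= M.
  rewrite le_min; apply/andP; split; last by rewrite ler_piMr ?exprn_ge0 // invf_le1.
  by rewrite ler_pdivrMr // ler_pdivlMl ?ltr0n.
have N0 : 0 <= N by exact: N_ge0.
have h1 : W^-1 * S * (3 / 10 * eta) <= M * Delta2 + N.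
  have : W^-1 * (3 / 10 * eta * S) <= W^-1 * (a ^+ T * Delta2 + N * W).
    by rewrite ler_wpM2l // invr_ge0 ltW.
  have := ler_wpM2r D0 WM.
  have -> : W^-1 * (a ^+ T * Delta2 + N * W) = a ^+ T / W * Delta2 + N by field; exact: lt0r_neq0.
  lra.
have h2 : W^-1 * S <= (M * Delta2 + N) / (3 / 10 * eta).
  by rewrite ler_pdivlMr ?mulr_gt0.
apply: le_trans h2 _.
have -> : (M * Delta2 + N) / (3 / 10 * eta) = 10 / 3 * (M * (Delta2 / eta))
   + 10 * (eta * sperp2) + 80 * ((E%:R - 1) * L * eta ^+ 2 * stilde2).
  by rewrite /N; field; rewrite lt0r_neq0.
have M0 : 0 <= M * (Delta2 / eta).
  by rewrite mulr_ge0 ?divr_ge0 // le_min invr_ge0 ler0n exprn_ge0.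
have s0 : 0 <= eta * sperp2 by rewrite mulr_ge0 // noise_perp_ge0.
lra.
Qed.

End Dynamics.

(** * Choice of the step size *)

Section StepSizes.
Context {R : realType}.
Implicit Types eta x s a q mu L : R.

Lemma le_inve_EFin eta x : 0 <= x -> (eta%:E <= (x%:E)^-1)%E = (eta * x <= 1).
Proof.
rewrite le_eqVlt => /orP[/eqP <-|x0]; first by rewrite inve0 leey mulr0 ler01.
by rewrite inver gt_eqF // lee_fin -ler_pdivlMr // mul1r.
Qed.

Lemma le_step_bound L mu E eta : 0 <= L -> 0 <= mu -> (1 <= E)%N ->
  (eta%:E <= step_bound L mu E)%E =
  (eta * (L * (E%:R + 9)) <= 1) && (eta * (mu + 25 * L * (E%:R - 1)) <= 1).
Proof.
move=> L0 mu0 E1; rewrite /step_bound le_min !le_inve_EFin //.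
  by rewrite addr_ge0 // !mulr_ge0 // subr_ge0 ler1n.
by rewrite mulr_ge0 // addr_ge0.
Qed.

(** A single closed form below both bounds: [E + 9 <= 25 * E], and [mu <= L] is absorbed by the
    [- 25 * L] of the second one. *)
Lemma step_bound_canonical L mu E eta : 0 < L -> 0 <= mu <= L -> (1 <= E)%N ->
  0 <= eta <= (25 * L * E%:R)^-1 -> (eta%:E <= step_bound L mu E)%E.
Proof.
move=> L0 /andP[mu0 muL] E1 /andP[e0 es].
have E1' : 1 <= E%:R :> R by rewrite ler1n.
have LE : 0 < 25 * L * E%:R by rewrite !mulr_gt0 // (lt_le_trans _ E1').
have h : eta * (25 * L * E%:R) <= 1 by rewrite -ler_pdivlMr // mul1r.
have h1 : 0 <= L * (E%:R - 1) by rewrite mulr_ge0 ?subr_ge0 // ltW.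
rewrite le_step_bound ?(ltW L0) //; apply/andP; split; apply: le_trans h; rewrite ler_wpM2l //.
  have : 0 <= L * E%:R by rewrite mulr_ge0 // ltW.
  lra.
lra.
Qed.

(** At the minimum of [s], [e1] and [e2] the noise terms, increasing in [eta], are at most [S1] and
    [S2], while [h] takes one of its three known values. *)
Lemma min_step (h : R -> R) s sig2 q S1 S2 :
  0 < s -> 0 <= sig2 -> 0 <= q -> 0 <= S1 -> 0 <= S2 ->
  (exists e1, [/\ 0 < e1, e1 * sig2 <= S1 & h e1 <= h s + S1]) ->
  (exists e2, [/\ 0 < e2, e2 ^+ 2 * q <= S2 & h e2 <= h s + S2]) ->
  exists eta, [/\ 0 < eta, eta <= s &
    h eta + eta * sig2 + eta ^+ 2 * q <= h s + 2 * S1 + 2 * S2].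
Proof.
move=> s0 sig0 q0 S10 S20 [e1 [e10 es1 he1]] [e2 [e20 es2 he2]].
pose eta := Num.min s (Num.min e1 e2).
have eta0 : 0 < eta by rewrite !lt_min s0 e10.
have le1 : eta <= e1 by rewrite /eta !ge_min lexx orbT.
have le2 : eta <= e2 by rewrite /eta !ge_min lexx !orbT.
have heta : h eta <= h s + S1 + S2.
  by rewrite /eta; case: (leP s) => _; last case: (leP e1) => _; lra.
exists eta; split => //; first by rewrite /eta ge_min lexx.
have := ler_wpM2r sig0 le1.
have : eta ^+ 2 * q <= e2 ^+ 2 * q by rewrite ler_wpM2r // lerXn2r // nnegrE ltW.
lra.
Qed.

(* [r] and [B] are the two noise terms of the rate; they are attained at
   [eta = r / sig2] and [eta = a / B] respectively. *)
Lemma sublinear_step s a sig2 q r B :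
  0 < s -> 0 < a -> 0 <= sig2 -> 0 <= q -> 0 <= r -> 0 <= B ->
  r ^+ 2 = a * sig2 -> B ^+ 3 = a ^+ 2 * q ->
  exists eta, [/\ 0 < eta, eta <= s &
    a / eta + eta * sig2 + eta ^+ 2 * q <= a / s + 2 * r + 2 * B].
Proof.
move=> s0 a0 sig0 q0 r0 B0 rE BE.
have as0 : 0 <= a / s by rewrite divr_ge0 ?ltW.
apply: (@min_step (fun eta => a / eta)) => //.
(* A vanishing noise term has no balancing step; [s] itself then serves. *)
- have [sE|sig] := eqVneq sig2 0.
    by exists s; split => //; rewrite ?sE ?mulr0 ?lerDl.
  have sig_gt0 : 0 < sig2 by rewrite lt0r sig.
  have rn0 : r != 0 by rewrite -sqrf_eq0 rE mulf_neq0 // lt0r_neq0.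
  have r_gt0 : 0 < r by rewrite lt0r rn0.
  exists (r / sig2); split; first exact: divr_gt0.
    by rewrite divfK.
  have -> : a / (r / sig2) = r.
    by rewrite invf_div mulrA -rE expr2 mulfK.
  by rewrite lerDr.
- have [qE|qn0] := eqVneq q 0.
    by exists s; split => //; rewrite ?qE ?mulr0 ?lerDl.
  have q_gt0 : 0 < q by rewrite lt0r qn0.
  have Bn0 : B != 0.
    apply/eqP => B00; move: BE; rewrite B00 expr0n => /esym/eqP.
    by rewrite mulf_eq0 expf_eq0 (gt_eqF a0) (gt_eqF q_gt0).
  have B_gt0 : 0 < B by rewrite lt0r Bn0.
  exists (a / B); split; first exact: divr_gt0.
    by rewrite expr_div_n mulrAC -BE exprSr mulrC mulKf // expf_neq0.
  by rewrite invf_div mulrC divfK ?lt0r_neq0 // lerDr.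
Qed.

Lemma logfactor_ge1 x : 0 <= x -> 1 <= logfactor x.
Proof.
move=> x0; rewrite /logfactor -[leLHS](expRK 1) ler_ln ?posrE ?expR_gt0 ?lerDl //.
by rewrite ltr_wpDr ?expR_gt0.
Qed.

Lemma expR_logfactor x : 0 <= x -> expR (- logfactor x) * x <= 1.
Proof.
move=> x0; have ex : 0 < expR 1 + x by rewrite ltr_wpDr ?expR_gt0.
rewrite expRN /logfactor lnK ?posrE // mulrC ler_pdivrMr // mul1r lerDr.
exact: expR_ge0.
Qed.

(* At [eta = log (e + X) / (mu T)] the contraction factor is at most [1 / X], which turns
   the initial distance into the noise level [N]. *)
Lemma logfactor_step mu (T Delta2 N X : R) : 0 < mu -> 0 < T -> 0 <= Delta2 -> 0 <= N -> 0 <= X ->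
  Delta2 * (mu * T) <= N * X ->
  let eta := logfactor X / (mu * T) in
  expR (- (mu * eta * T)) * (Delta2 / eta) <= N.
Proof.
move=> mu0 T0 D0 N0 X0 h /=.
have l1 := logfactor_ge1 X0; have l0 : 0 < logfactor X by exact: lt_le_trans l1.
have mT : 0 < mu * T by rewrite mulr_gt0.
have -> : mu * (logfactor X / (mu * T)) * T = logfactor X by field; rewrite !lt0r_neq0.
have -> : Delta2 / (logfactor X / (mu * T)) = Delta2 * (mu * T) / logfactor X.
  by field; rewrite !lt0r_neq0.
apply: (@le_trans _ _ (expR (- logfactor X) * (N * X))).
  rewrite ler_wpM2l ?expR_ge0 //; apply: le_trans h.
  by rewrite ler_pdivrMr // ler_peMr // mulr_ge0 // ltW.
rewrite mulrCA -[leRHS]mulr1 ler_wpM2l //; exact: expR_logfactor.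
Qed.

(** Each logarithm is taken of [Delta2 * (mu * T)] divided by the noise level [sig2 / (mu * T)] or
    [q / (mu ^+ 2 * T ^+ 2)], as [logfactor_step] requires. *)
Lemma exponential_step mu (T s Delta2 sig2 q : R) :
  0 < mu -> 0 < T -> 0 < s -> 0 <= Delta2 -> 0 <= sig2 -> 0 <= q ->
  let l1 := logfactor (mu ^+ 2 * T ^+ 2 * Delta2 / sig2) in
  let l2 := logfactor (mu ^+ 3 * T ^+ 3 * Delta2 / q) in
  exists eta, [/\ 0 < eta, eta <= s &
    expR (- (mu * eta * T)) * (Delta2 / eta) + eta * sig2 + eta ^+ 2 * q <=
    expR (- (mu * s * T)) * (Delta2 / s) + 2 * (l1 ^+ 2 * (sig2 / (mu * T)))
      + 2 * (l2 ^+ 2 * (q / (mu ^+ 2 * T ^+ 2)))].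
Proof.
move=> mu0 T0 s0 D0 sig0 q0 l1 l2.
have mT : 0 < mu * T by rewrite mulr_gt0.
have mT2 : 0 < mu ^+ 2 * T ^+ 2 by rewrite mulr_gt0 ?exprn_gt0.
have X1 : 0 <= mu ^+ 2 * T ^+ 2 * Delta2 / sig2 by rewrite !mulr_ge0 ?exprn_ge0 ?invr_ge0 // ltW.
have X2 : 0 <= mu ^+ 3 * T ^+ 3 * Delta2 / q by rewrite !mulr_ge0 ?exprn_ge0 ?invr_ge0 // ltW.
have l11 : 1 <= l1 by exact: logfactor_ge1.
have l21 : 1 <= l2 by exact: logfactor_ge1.
have l12 : 1 <= l1 ^+ 2 by exact: exprn_ege1.
have l22 : 1 <= l2 ^+ 2 by exact: exprn_ege1.
have N1 : 0 <= sig2 / (mu * T) by rewrite divr_ge0 // ltW.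
have N2 : 0 <= q / (mu ^+ 2 * T ^+ 2) by rewrite divr_ge0 // ltW.
have h0 : 0 <= expR (- (mu * s * T)) * (Delta2 / s).
  by rewrite mulr_ge0 ?expR_ge0 // divr_ge0 // ltW.
have S1 : 0 <= l1 ^+ 2 * (sig2 / (mu * T)) by rewrite mulr_ge0 ?sqr_ge0.
have S2 : 0 <= l2 ^+ 2 * (q / (mu ^+ 2 * T ^+ 2)) by rewrite mulr_ge0 ?sqr_ge0.
apply: (@min_step (fun eta => expR (- (mu * eta * T)) * (Delta2 / eta))) => //.
- have [sE|sig] := eqVneq sig2 0.
    by exists s; split => //; [rewrite {1}sE mulr0|rewrite lerDl].
  have sig_gt0 : 0 < sig2 by rewrite lt0r sig.
  exists (l1 / (mu * T)); split.
  + by rewrite divr_gt0 // (lt_le_trans _ l11).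
  (* One power of [l1] would do here; the term in [q], quadratic in the step, requires two, and
     [l1 >= 1] allows the same exponent in both. *)
  + rewrite mulrAC -mulrA ler_wpM2r // expr2 ler_peMr //; exact: le_trans l11.
  + apply: (@le_trans _ _ (sig2 / (mu * T))); last by rewrite -[leLHS]add0r lerD // ler_peMl.
    apply: logfactor_step => //.
    rewrite (_ : _ / _ * _ = Delta2 * (mu * T)) //.
    by field; rewrite !lt0r_neq0.
- have [qE|qn0] := eqVneq q 0.
    by exists s; split => //; [rewrite {1}qE mulr0|rewrite lerDl].
  have q_gt0 : 0 < q by rewrite lt0r qn0.
  exists (l2 / (mu * T)); split.
  + by rewrite divr_gt0 // (lt_le_trans _ l21).
  + by rewrite expr_div_n exprMn mulrAC mulrA.
  + apply: (@le_trans _ _ (q / (mu ^+ 2 * T ^+ 2))); last by rewrite -[leLHS]add0r lerD // ler_peMl.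
    apply: logfactor_step => //.
    rewrite (_ : _ / _ * _ = Delta2 * (mu * T)) //.
    by field; rewrite !lt0r_neq0.
Qed.

Lemma contraction_le_expR mu eta (T : nat) : 0 <= 1 - mu * eta ->
  (1 - mu * eta) ^+ T <= expR (- (mu * eta * T%:R)).
Proof.
move=> h; rewrite -[X in expR X]mulNr expRM_natr lerXn2r ?nnegrE ?expR_ge0 //.
exact: expR_ge1Dx.
Qed.

Lemma powR_third_cube x : 0 <= x -> (x `^ 3^-1) ^+ 3 = x.
Proof.
move=> x0; rewrite -powR_mulrn ?powR_ge0 // -powRrM mulVf ?powRr1 //.
Qed.

Lemma powR_two_thirds_cube x : 0 <= x -> (x `^ (2 / 3)) ^+ 3 = x ^+ 2.
Proof.
move=> x0; rewrite -powR_mulrn ?powR_ge0 // -powRrM divfK // powR_mulrn //.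
Qed.

End StepSizes.

Theorem theorem3p2 (R : realType) :
  exists (C c : R) (k : nat), 0 < C /\ 0 < c /\
  forall (p m : nat) (A : 'M[R]_(p, m))
    (d d' : measure_display) (Xi : measurableType d) (Omega : measurableType d')
    (D : probability Xi R) (P : probability Omega R)
    (f : 'cV[R]_p -> Xi -> R) (L mu : R) (xs : 'cV[R]_p)
    (x0 : Omega -> 'cV[R]_p) (xi : nat -> Omega -> Xi)
    (I : pred nat) (T E : nat),
  let F := objective D f in
  let Delta2 := fine (init_dist P A x0 xs) in
  let Delta := Num.sqrt Delta2 in
  let sigma_perp2 := fine (noise_perp D f A xs) in
  let sigma_perp := Num.sqrt sigma_perp2 in
  let sigma_tilde2 :=
    fine (noise_range D f A xs) + (E%:R - 1) * enorm (grad F xs) ^+ 2 in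
  let sigma_tilde := Num.sqrt sigma_tilde2 in
  let error eta := expected_error D P f A I mu eta T x0 xi xs in
  (exists x : 'cV[R]_p, x != 0 /\ in_Aperp A x) ->
  (forall x, D.-integrable setT (EFin \o f x)) ->
  (forall z x, differentiable (f ^~ z) x) ->
  (forall z, convex_function setT (f ^~ z)) ->
  (forall z, lipschitz_grad L (f ^~ z)) ->
  gradient_mean D f ->
  0 <= mu -> strongly_convex mu F ->
  constrained_min A F xs ->
  noise_perp D f A xs \is a fin_num ->
  noise_range D f A xs \is a fin_num ->
  iid_sample D P x0 xi ->
  (forall w, in_Aperp A (x0 w)) ->
  init_dist P A x0 xs \is a fin_num ->
  gap T I = E -> (1 <= E)%N ->
  [/\ forall eta : R, 0 < eta -> (eta%:E <= step_bound L mu E)%E ->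
        (error eta <=
          (C * (Num.min T%:R^-1 ((1 - mu * eta) ^+ T) * (Delta2 / eta)
                + eta * sigma_perp2
                + (E%:R - 1) * L * eta ^+ 2 * sigma_tilde2))%:E)%E,
      mu = 0 ->
        exists eta : R, [/\ 0 <= eta, (0 < Delta -> 0 < eta),
          (eta%:E <= step_bound L mu E)%E &
          (error eta <=
            (C * (L * E%:R * Delta2 / T%:R
                  + Delta / Num.sqrt T%:R * sigma_perp
                  + ((E%:R - 1) * L * Delta ^+ 4) `^ (3^-1) / T%:R `^ (2 / 3)
                    * sigma_tilde `^ (2 / 3)))%:E)%E] &
      0 < mu ->
        let kappa := L / mu in
        exists eta : R, [/\ 0 < eta, (eta%:E <= step_bound L mu E)%E &
          (error eta <=
            (C * (L * E%:R * Delta2 * expR (- (c * (T%:R / (kappa * E%:R))))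
                  + logfactor (mu ^+ 2 * T%:R ^+ 2 * Delta2 / sigma_perp2) ^+ k
                    * (sigma_perp2 / (mu * T%:R))
                  + logfactor (mu ^+ 3 * T%:R ^+ 3 * Delta2
                               / ((E%:R - 1) * L * sigma_tilde2)) ^+ k
                    * ((E%:R - 1) * L * sigma_tilde2 / (mu ^+ 2 * T%:R ^+ 2)))
             )%:E)%E]].
Proof.
(* 2000 is the 80 of [expected_error_le] times the 25 that the largest step [(25 * L * E)^-1] puts
   in front of the distance term. *)
have [C [C0 C2000]] : exists C : R, 0 < C /\ 2000 <= C.
  by exists 2000; rewrite ltr0n lexx.
have scaleC (x y : R) : 0 <= y -> x <= 2000 * y -> x <= C * y.
  by move=> y0 /le_trans; apply; rewrite ler_wpM2r.
exists C, (1 / 25), 2%N; split => //; split; first by rewrite divr_gt0.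
move=> p m A d d' Xi Omega D P f L mu xs x0 xi I T E F Delta2 Delta sigma_perp2 sigma_perp
  sigma_tilde2 sigma_tilde error nontriv f_int f_diff f_convex f_lip f_grad mu0 F_strong
  xs_min perp_fin range_fin iid x0_in init_fin gapE E1.
have L0 : 0 <= L := L_ge0 nontriv f_lip.
have muL : mu <= L := mu_le_L nontriv f_lip f_grad F_strong.
(* With [T = 0] the only projection time is 0, so the gap would be 0. *)
have T0 : (0 < T)%N.
  rewrite lt0n; apply/eqP => TE; move: E1.
  by rewrite -gapE TE /gap /projection_times /= big_seq1.
have TR : 0 < T%:R :> R by rewrite ltr0n.
have D0 : 0 <= Delta2 by apply/fine_ge0/expectation_ge0 => w; exact: sqr_ge0.
have sp0 : 0 <= sigma_perp2 := noise_perp_ge0 _ _ _ _.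
have st0 : 0 <= sigma_tilde2 := noise_tilde_ge0 _ _ _ _ E1.
have E10 : 0 <= E%:R - 1 :> R by rewrite subr_ge0 ler1n.
have E0 : 0 < E%:R :> R by rewrite ltr0n.
have bound eta : 0 < eta -> (eta%:E <= step_bound L mu E)%E ->
  (error eta <= (80 * (Num.min T%:R^-1 ((1 - mu * eta) ^+ T) * (Delta2 / eta)
     + eta * sigma_perp2 + (E%:R - 1) * L * eta ^+ 2 * sigma_tilde2))%:E)%E /\
  0 <= 1 - mu * eta.
  move=> eta0; rewrite le_step_bound // => /andP[s1 s2]; split.
    exact: (expected_error_le nontriv f_int f_diff f_convex f_lip f_grad mu0 F_strong
      xs_min perp_fin range_fin iid x0_in init_fin gapE eta0 s1 s2 T0).
  rewrite subr_ge0 mulrC; apply: le_trans s2; rewrite ler_wpM2l ?(ltW eta0) //.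
  by rewrite lerDl !mulr_ge0.
pose q := (E%:R - 1) * L * sigma_tilde2.
have q0 : 0 <= q by rewrite !mulr_ge0.
split.
- move=> eta eta0 etas; have [h me] := bound eta eta0 etas.
  apply: le_trans h _; rewrite lee_fin.
  have m0 : 0 <= Num.min T%:R^-1 ((1 - mu * eta) ^+ T).
    by rewrite le_min invr_ge0 ler0n exprn_ge0.
  have eta0' := ltW eta0.
  have rhs0 : 0 <= Num.min T%:R^-1 ((1 - mu * eta) ^+ T) * (Delta2 / eta)
      + eta * sigma_perp2 + (E%:R - 1) * L * eta ^+ 2 * sigma_tilde2.
    by rewrite !addr_ge0 // !mulr_ge0 ?invr_ge0 ?exprn_ge0.
  by apply: scaleC => //; lra.
- move=> muE.
  have DE : Delta ^+ 2 = Delta2 by rewrite sqr_sqrtr.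
  have De0 : 0 <= Delta by exact: sqrtr_ge0.
  set r := Delta / Num.sqrt T%:R * sigma_perp.
  set B := _ `^ (3^-1) / _ * _.
  have r0 : 0 <= r by rewrite !mulr_ge0 ?invr_ge0 ?sqrtr_ge0.
  have B0 : 0 <= B by rewrite !mulr_ge0 ?invr_ge0 ?powR_ge0.
  have lead0 : 0 <= L * E%:R * Delta2 / T%:R by rewrite !mulr_ge0 ?invr_ge0 // ltW.
  have sum0 : 0 <= L * E%:R * Delta2 / T%:R + r + B by do 2 apply: addr_ge0 => //.
  have rhs0 : 0 <= C * (L * E%:R * Delta2 / T%:R + r + B) by apply: mulr_ge0 => //; exact: ltW.
  (* Here [(25 * L * E)^-1] would be 0. With [L = mu = 0] every positive step is admissible and the
     error is 0, so 1 is an arbitrary choice. *)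
  have [LE|Ln0] := eqVneq L 0.
    exists 1; split => //.
      rewrite le_step_bound //; apply/andP.
      by rewrite muE LE !(mul0r, mulr0, mul1r) addr0 ler01.
    apply: (@le_trans _ _ 0%E); last by rewrite lee_fin.
    exact: (expected_error_L0 mu I T nontriv f_int f_diff f_convex f_lip f_grad
      xs_min iid init_fin 1 LE).
  have Lp : 0 < L by rewrite lt0r Ln0.
  have s0 : 0 < (25 * L * E%:R)^-1 by rewrite invr_gt0 !mulr_gt0.
  (* The right-hand side vanishes with [Delta], whereas a positive step may bring in noise;
     [eta = 0] keeps the iterates at [x0]. *)
  have [DelE|Deln0] := eqVneq Delta 0.
    exists 0; split => //; first by rewrite DelE ltxx.
      by apply: step_bound_canonical => //; [rewrite mu0|rewrite lexx ltW].
    apply: (@le_trans _ _ (L * Delta2)%:E); last first.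
      by rewrite (_ : L * Delta2 = 0) ?lee_fin // -DE DelE expr0n mulr0.
    exact: (expected_error_eta0 mu I nontriv f_int f_diff f_convex f_lip f_grad
      xs_min iid x0_in init_fin).
  have Delp : 0 < Delta by rewrite lt0r Deln0.
  have a0 : 0 < Delta2 / T%:R by rewrite divr_gt0 // -DE exprn_gt0.
  have rE : r ^+ 2 = Delta2 / T%:R * sigma_perp2.
    by rewrite /r exprMn expr_div_n DE !sqr_sqrtr // ler0n.
  have BE : B ^+ 3 = (Delta2 / T%:R) ^+ 2 * q.
    rewrite /B exprMn expr_div_n powR_third_cube ?mulr_ge0 ?exprn_ge0 //.
    rewrite !powR_two_thirds_cube ?ler0n ?sqrtr_ge0 // sqr_sqrtr // /q -DE.
    by field; rewrite lt0r_neq0.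
  have [eta [eta0 etas h]] := sublinear_step s0 a0 sp0 q0 r0 B0 rE BE.
  have sb : (eta%:E <= step_bound L mu E)%E.
    by apply: step_bound_canonical; rewrite ?mu0 ?(ltW eta0).
  exists eta; split => //; first exact: ltW.
  apply: le_trans (bound eta eta0 sb).1 _; rewrite lee_fin.
  have : Num.min T%:R^-1 ((1 - mu * eta) ^+ T) * (Delta2 / eta) <= Delta2 / T%:R / eta.
    rewrite [leRHS]mulrAC [leRHS]mulrC ler_wpM2r ?divr_ge0 ?(ltW eta0) //.
    by rewrite ge_min lexx.
  have : Delta2 / T%:R / (25 * L * E%:R)^-1 = 25 * (L * E%:R * Delta2 / T%:R).
    by rewrite invrK; ring.
  by move: h; rewrite /q => *; apply: scaleC => //; lra.
- move=> mup kappa.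
  have Lp : 0 < L by exact: lt_le_trans muL.
  have s0 : 0 < (25 * L * E%:R)^-1 by rewrite invr_gt0 !mulr_gt0.
  have [eta [eta0 etas]] := exponential_step mup TR s0 D0 sp0 q0.
  rewrite {2 3}/q; set l1 := logfactor _; set l2 := logfactor _ => h.
  have sb : (eta%:E <= step_bound L mu E)%E.
    by apply: step_bound_canonical; rewrite ?mu0 ?(ltW eta0).
  have [err me] := bound eta eta0 sb.
  exists eta; split => //.
  apply: le_trans err _; rewrite lee_fin.
  (* The power is kept here, where the case [mu = 0] keeps [T^-1]. *)
  have h1 : Num.min T%:R^-1 ((1 - mu * eta) ^+ T) * (Delta2 / eta) <=
      expR (- (mu * eta * T%:R)) * (Delta2 / eta).
    rewrite ler_wpM2r ?divr_ge0 ?(ltW eta0) // (le_trans _ (contraction_le_expR T me)) //.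
    by rewrite ge_min lexx orbT.
  have e1 : expR (- (mu * (25 * L * E%:R)^-1 * T%:R)) * (Delta2 / (25 * L * E%:R)^-1) =
     25 * (L * E%:R * Delta2 * expR (- (1 / 25 * (T%:R / (kappa * E%:R))))).
    have -> : 1 / 25 * (T%:R / (kappa * E%:R)) = mu * (25 * L * E%:R)^-1 * T%:R.
      by rewrite /kappa; field; rewrite !lt0r_neq0.
    by rewrite invrK; ring.
  have t1 : 0 <= L * E%:R * Delta2 * expR (- (1 / 25 * (T%:R / (kappa * E%:R)))).
    by rewrite !mulr_ge0 ?expR_ge0 // ltW.
  have t2 : 0 <= l1 ^+ 2 * (sigma_perp2 / (mu * T%:R)).
    by rewrite mulr_ge0 ?sqr_ge0 // divr_ge0 // mulr_ge0.
  have t3 : 0 <= l2 ^+ 2 * ((E%:R - 1) * L * sigma_tilde2 / (mu ^+ 2 * T%:R ^+ 2)).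
    by rewrite mulr_ge0 ?sqr_ge0 // divr_ge0 // mulr_ge0 ?sqr_ge0.
  move: h; rewrite e1; move: h1; rewrite /q => *.
  by apply: scaleC; [rewrite !addr_ge0|lra].
Qed.
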